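(* The orientable surface groups $$S_g=\langle a_1,\dots,a_g,b_1,\dots,b_g\mid[a_1,b_1]\cdots[a_g,b_g]=1\rangle,$$ and the non-orientable ones $$\mathcal{N}_g=\langle a_1,\dots,a_g\mid a_1^2\cdots a_g^2=1\rangle,$$ all have decidable prefix membership problem with linear upper distortion function.
   Context: $[a,b]=aba^{-1}b^{-1}$. The prefix monoid of a one-relator group $\langle A\mid w=1\rangle$ (with respect to this presentation) is the submonoid $P$ of the group generated by the elements represented by all prefixes of the word $w$. The group (with this presentation) has decidable prefix membership problem if membership in $P$ is decidable, that is, there is an algorithm that takes any word over $A\cup A^{-1}$ and decides whether the element of the group it represents belongs to $P$. Here the prefix membership problem is taken with respect to the displayed presentations, and the upper distortion function in the statement is that of the prefix monoid $P$ in the group. A monoid $M$ is graded if it admits a finite generating set $S$ such that every element of $M$ can be expressed as a word over $S$ in only finitely many ways; $M$ is then said to be graded with respect to $S$ (and then it is graded with respect to every finite generating set not containing $1$). If $M$ is graded with respect to $S$, the upper word length function is $\lambda_S(g)=\max\{k\mid g=s_1\cdots s_k \text{ for some } s_i\in S\}$; it is taken with respect to generating sets not containing $1$. For a monoid $G$ generated by a finite set $X$ (for a group, a finite monoid generating set), $|g|_X$ is the least $k$ such that $g$ is a product of $k$ elements of $X$. If $M$, graded with respect to the finite set $S$, is a submonoid of $G$ generated by the finite set $X$, an upper distortion function for $M$ in $G$ with respect to $S$ and $X$ is any non-decreasing function $\lambda:\mathbb{N}\to\mathbb{N}$ such that $\lambda_S(g)\leq\lambda(|g|_X)$ for all $g\in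 M$. It is linear if there are constants $\alpha,\beta>0$ with $\lambda(n)\leq\alpha n+\beta$ for all $n\in\mathbb{N}$.
   Formalization: The linear upper distortion claim is stated for all the non-orientable groups except g = 1: there the group is Z/2, its prefix monoid is the whole group and is not graded, so an upper distortion function is undefined; decidability is still asserted for g = 1. *)

(* Defs.v *)
From HB Require Import structures.
From mathcomp Require Import all_boot all_order.
From mathcomp Require Import generic_quotient.
From mathcomp Require Import boolp classical_sets functions cardinality.

Set Implicit Arguments.
Unset Strict Implicit.
Unset Printing Implicit Defensive.

Local Open Scope classical_set_scope.
Local Open Scope quotient_scope.

(* Kleene's total recursive functions, as the least class of functions
   nat^k -> nat containing zero, successor and the projections and closed under
   composition, primitive recursion and minimisation of regular functions.
   In rec_prim and rec_mu the constructed function is pinned down by its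
   defining equations. *)
Inductive recursive : forall k, (k.-tuple nat -> nat) -> Prop :=
| rec_zero k : recursive (fun _ : k.-tuple nat => 0)
| rec_succ : recursive (fun v : 1.-tuple nat => (thead v).+1)
| rec_proj k (i : 'I_k) : recursive (fun v : k.-tuple nat => tnth v i)
| rec_comp k m (f : m.-tuple nat -> nat) (h : 'I_m -> k.-tuple nat -> nat) :
    recursive f -> (forall i, recursive (h i)) ->
    recursive (fun v : k.-tuple nat => f [tuple h i v | i < m])
| rec_prim k (f : k.-tuple nat -> nat) (s : k.+2.-tuple nat -> nat)
    (h : k.+1.-tuple nat -> nat) :
    recursive f -> recursive s ->
    (forall v : k.-tuple nat, h [tuple of 0 :: v] = f v) ->
    (forall n (v : k.-tuple nat),
      h [tuple of n.+1 :: v] = s [tuple of n :: h [tuple of n :: v] :: v]) ->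
    recursive h
| rec_mu k (f : k.+1.-tuple nat -> nat) (h : k.-tuple nat -> nat) :
    recursive f ->
    (forall v : k.-tuple nat, f [tuple of h v :: v] = 0) ->
    (forall (v : k.-tuple nat) m, m < h v -> f [tuple of m :: v] != 0) ->
    recursive h.

(* Bijective base-#|T| numeration, a bijection from words over T to nat when T
   is nonempty. *)
Fixpoint word_code (T : finType) (u : seq T) : nat :=
  if u is x :: u' then #|T| * word_code u' + (enum_rank x).+1 else 0.

(* There is an algorithm deciding L: the characteristic function of L is
   recursive. *)
Definition decidable_language (T : finType) (L : set (seq T)) : Prop :=
  exists2 f : 1.-tuple nat -> nat,
    recursive f & forall u, f [tuple word_code u] = `[< L u >].

Section GradedMonoids.
Variable G : monoidType.
Implicit Types (P S X : set G) (g : G).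

Definition factorizations S g : set (seq G) :=
  [set s | {in s, forall x, S x} /\ (\prod_(x <- s) x)%g = g].

Definition submonoid_gen S : set G := [set g | factorizations S g !=set0].

Definition finitely_generates S P : Prop :=
  finite_set S /\ submonoid_gen S = P.

Definition graded_wrt P S : Prop :=
  finitely_generates S P /\ forall g, P g -> finite_set (factorizations S g).

Definition graded P : Prop := exists S, graded_wrt P S.

Definition factorization_lengths S g : set nat := size @` factorizations S g.

(* The default value 0 is only used if the maximum (resp. minimum) does not
   exist. *)
Definition upper_word_length S g : nat :=
  let L := factorization_lengths S g in xget 0 (L `&` ubound L).

Definition word_length X g : nat :=
  let L := factorization_lengths X g in xget 0 (L `&` lbound L).

Definition upper_distortion P S X (lam : nat -> nat) : Prop :=
  {homo lam : m n / m <= n} /\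
  forall g, P g -> upper_word_length S g <= lam (word_length X g).

(* P is graded and, whatever the finite generating sets S of P (with respect to
   which P is graded) and X of G, P has a linear upper distortion function. *)
Definition has_linear_upper_distortion P : Prop :=
  graded P /\
  forall S X, graded_wrt P S -> finitely_generates X [set: G] ->
    exists2 lam, upper_distortion P S X lam &
      exists alpha beta : nat,
        [/\ 0 < alpha, 0 < beta & forall n, lam n <= alpha * n + beta].

End GradedMonoids.

(* Words over A and its formal inverses: (a, false) is the letter a and
   (a, true) is the letter a^-1. *)
Definition letter (A : finType) : finType := (A * bool)%type.
Notation word A := (seq (letter A)).

Definition inv_letter (A : finType) (x : letter A) : letter A := (x.1, ~~ x.2).
Definition inv_word (A : finType) (u : word A) : word A :=
  rev (map (@inv_letter A) u).

Inductive pres_eq (A : finType) (w : word A) : word A -> word A -> Prop :=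
| pres_refl u : pres_eq w u u
| pres_sym u v : pres_eq w u v -> pres_eq w v u
| pres_trans v u t : pres_eq w u v -> pres_eq w v t -> pres_eq w u t
| pres_free u x v : pres_eq w (u ++ [:: x; inv_letter x] ++ v) (u ++ v)
| pres_relator u v : pres_eq w (u ++ w ++ v) (u ++ v).

Section OneRelatorGroup.
Variables (A : finType) (w : word A).
Implicit Types u v : word A.

Definition pres_eqb : rel (word A) := fun u v => `[< pres_eq w u v >].

Lemma pres_eqb_equiv : equiv_class_of pres_eqb.
Proof.
split=> [u|u v|v u t].
- exact/asboolP/pres_refl.
- by apply/asboolP/asboolP => /pres_sym.
- by move=> /asboolP uv /asboolP vt; apply/asboolP/(pres_trans uv vt).
Qed.

Canonical pres_equiv := EquivRelPack pres_eqb_equiv.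

(* The group < A | w = 1 >. *)
Definition one_relator := {eq_quot pres_equiv}.
HB.instance Definition _ := Choice.on one_relator.

(* The element of < A | w = 1 > represented by the word u. *)
Definition elt (u : word A) : one_relator := \pi_(one_relator) u.

Lemma eltP u v : elt u = elt v <-> pres_eq w u v.
Proof.
split; first by move/eqmodP/asboolP.
by move=> uv; apply/eqmodP/asboolP.
Qed.

Lemma elt_surj (x : one_relator) : elt (repr x) = x.
Proof. exact: reprK. Qed.

Lemma pres_cat u u' v v' :
  pres_eq w u u' -> pres_eq w v v' -> pres_eq w (u ++ v) (u' ++ v').
Proof.
move=> uu' vv'; apply: (@pres_trans _ _ (u' ++ v)).
  elim: uu' => {u u'} [u|u u' _|u1 u u2 _ IH1 _ IH2|u x u'|u u'].
  - exact: pres_refl.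
  - exact: pres_sym.
  - exact: pres_trans IH1 IH2.
  - by rewrite -!catA; apply: pres_free.
  - by rewrite -!catA; apply: pres_relator.
elim: vv' => {v v'} [v|v v' _|v1 v v2 _ IH1 _ IH2|v x v'|v v'].
- exact: pres_refl.
- exact: pres_sym.
- exact: pres_trans IH1 IH2.
- by rewrite !(catA u'); apply: pres_free.
- by rewrite !(catA u'); apply: pres_relator.
Qed.

Lemma inv_letterK : involutive (@inv_letter A).
Proof. by case=> a b; rewrite /inv_letter /= negbK. Qed.

Lemma inv_word_cat u v : inv_word (u ++ v) = inv_word v ++ inv_word u.
Proof. by rewrite /inv_word map_cat rev_cat. Qed.

Lemma inv_wordK : involutive (@inv_word A).
Proof.
by move=> u; rewrite /inv_word map_rev revK -map_comp map_id_in // => x _;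
  apply: inv_letterK.
Qed.

Lemma pres_mulV u : pres_eq w (u ++ inv_word u) [::].
Proof.
elim: u => [|x u IH]; first exact: pres_refl.
rewrite -cat1s inv_word_cat -catA (catA u).
apply: (@pres_trans _ _ ([:: x] ++ [::] ++ inv_word [:: x])).
  by apply: pres_cat; [exact: pres_refl|apply: pres_cat => //; exact: pres_refl].
exact: (@pres_free _ w [::] x [::]).
Qed.

Lemma pres_Vmul u : pres_eq w (inv_word u ++ u) [::].
Proof. by rewrite -{2}(inv_wordK u); apply: pres_mulV. Qed.

Lemma pres_inv u v : pres_eq w u v -> pres_eq w (inv_word u) (inv_word v).
Proof.
move=> uv; apply: (@pres_trans _ _ (inv_word u ++ v ++ inv_word v)).
  rewrite -{1}(cats0 (inv_word u)); apply: pres_cat; first exact: pres_refl.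
  exact/pres_sym/pres_mulV.
rewrite catA -{2}(cat0s (inv_word v)); apply: pres_cat; last exact: pres_refl.
apply: pres_trans (pres_Vmul u); apply: pres_cat; first exact: pres_refl.
exact: pres_sym.
Qed.

Definition one_relator_one : one_relator := elt [::].
Definition one_relator_mul (x y : one_relator) : one_relator :=
  elt (repr x ++ repr y).
Definition one_relator_inv (x : one_relator) : one_relator :=
  elt (inv_word (repr x)).

Lemma pres_repr u : pres_eq w (repr (elt u)) u.
Proof. by apply/eltP; rewrite elt_surj. Qed.

Lemma one_relator_mulE u v : one_relator_mul (elt u) (elt v) = elt (u ++ v).
Proof. by apply/eltP/pres_cat; apply: pres_repr. Qed.

Lemma one_relator_invE u : one_relator_inv (elt u) = elt (inv_word u).
Proof. exact/eltP/pres_inv/pres_repr. Qed.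

Lemma one_relator_mulA : associative one_relator_mul.
Proof.
move=> x y z; rewrite -(elt_surj x) -(elt_surj y) -(elt_surj z).
by rewrite !one_relator_mulE catA.
Qed.

Lemma one_relator_mul1 : left_id one_relator_one one_relator_mul.
Proof. by move=> x; rewrite -(elt_surj x) one_relator_mulE. Qed.

Lemma one_relator_mulr1 : right_id one_relator_one one_relator_mul.
Proof. by move=> x; rewrite -(elt_surj x) one_relator_mulE cats0. Qed.

Lemma one_relator_mulV :
  left_inverse one_relator_one one_relator_inv one_relator_mul.
Proof.
move=> x; rewrite -(elt_surj x) one_relator_invE one_relator_mulE.
exact/eltP/pres_Vmul.
Qed.

Lemma one_relator_mulrV :
  right_inverse one_relator_one one_relator_inv one_relator_mul.
Proof.
move=> x; rewrite -(elt_surj x) one_relator_invE one_relator_mulE.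
exact/eltP/pres_mulV.
Qed.

HB.instance Definition _ := isGroup.Build one_relator
  one_relator_mulA one_relator_mul1 one_relator_mulr1
  one_relator_mulV one_relator_mulrV.

Lemma elt_cat u v : elt (u ++ v) = (elt u * elt v)%g.
Proof. by rewrite -one_relator_mulE. Qed.

Lemma elt_nil : elt [::] = 1%g.
Proof. by []. Qed.

Lemma elt_inv u : elt (inv_word u) = ((elt u)^-1)%g.
Proof. by rewrite -one_relator_invE. Qed.

Lemma elt_relator : elt w = 1%g.
Proof.
by apply/eltP; have := pres_relator w [::] [::]; rewrite /= cats0.
Qed.

Definition prefix_monoid : set one_relator :=
  submonoid_gen [set elt u | u in [set u | prefix u w]].

Definition decidable_prefix_membership : Prop :=
  decidable_language [set u : word A | prefix_monoid (elt u)].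

End OneRelatorGroup.

Arguments elt {A} w u.
Arguments prefix_monoid {A} w _.

(* [a_1,b_1]...[a_g,b_g] with [a,b] = a b a^-1 b^-1; the generators a_i and b_i
   are inl i and inr i. *)
Definition orientable_relator (g : nat) : word ('I_g + 'I_g)%type :=
  flatten [seq [:: (inl i, false); (inr i, false); (inl i, true); (inr i, true)]
          | i <- enum 'I_g].

(* a_1^2...a_g^2 *)
Definition nonorientable_relator (g : nat) : word 'I_g :=
  flatten [seq [:: (i, false); (i, false)] | i <- enum 'I_g].

Lemma factorizations_cat (G : monoidType) (S : set G) x y s t :
  factorizations S x s -> factorizations S y t ->
  factorizations S (x * y)%g (s ++ t).
Proof.
move=> [Ss <-] [St <-]; split; last by rewrite big_cat.
by move=> z; rewrite mem_cat => /orP[/Ss|/St].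
Qed.

Lemma graded_torsion_free (G : monoidType) (P : set G) x n :
  graded P -> P x -> 0 < n -> (x ^+ n = 1)%g -> x = 1%g.
Proof.
move=> [S [[_ genS] finS]] Px n0 xn.
have [s Ssx] : submonoid_gen S x by rewrite genS.
have pow y t k : factorizations S y t ->
    factorizations S (y ^+ k)%g (flatten (nseq k t)).
  move=> Syt; elim: k => [|k IH]; first by split=> //; rewrite big_nil.
  by rewrite expgS; apply: factorizations_cat.
have P1 : P 1%g by rewrite -genS; exists [::]; split; rewrite ?big_nil.
have S1 k : factorizations S 1%g (flatten (nseq k (flatten (nseq n s)))).
  by have := pow _ _ k (pow _ _ n Ssx); rewrite xn expg1n.
case: s Ssx S1 {pow} => [[_ <-] _|z s _ S1]; first by rewrite big_nil.
exfalso; set t := flatten (nseq n _) in S1.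
have t0 : 0 < size t by rewrite /t; case: (n) n0.
apply: infinite_nat.
apply: (@sub_finite_set _ _ ((fun k => flatten (nseq k t)) @^-1`
  factorizations S 1%g)); first by move=> k _; apply: S1.
apply: finite_preimage; last exact: finS.
move=> i j _ _ /(congr1 size); rewrite !size_flatten /shape !map_nseq.
by rewrite !sumn_nseq => /eqP; rewrite eqn_pmul2l // => /eqP.
Qed.

(* The group < a | a^2 = 1 > is Z/2, and a lies in its prefix monoid. *)
Lemma nonorientable1_not_graded :
  ~ graded (prefix_monoid (nonorientable_relator 1)).
Proof.
set w := nonorientable_relator 1 => gr.
have wE : w = [:: (ord0, false); (ord0, false)].
  by rewrite /w /nonorientable_relator enum_ordSl enum_ord0.
pose a := elt w [:: (ord0, false)].
have Pa : prefix_monoid w a.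
  exists [:: a]; split; last by rewrite big_seq1.
  move=> x; rewrite inE => /eqP ->; exists [:: (ord0, false)] => //=.
  by rewrite wE.
have a2 : (a ^+ 2 = 1)%g by rewrite expgS expg1 -elt_cat -(elt_relator w) wE.
have /eltP a1 := @graded_torsion_free _ _ a 2 gr Pa isT a2.
have inv u v : pres_eq w u v -> odd (size u) = odd (size v).
  elim=> {u v} // [u v t _ -> _ ->//|u x v|u v];
    by rewrite ?wE !size_cat /= !oddD /= ?negbK.
by have := inv _ _ a1.
Qed.

(* Main.v *)
Require Import Defs.
From mathcomp Require Import all_boot all_order ssralg ssrnum ssrint zify.
From mathcomp Require Import boolp classical_sets cardinality.

Set Implicit Arguments.
Unset Strict Implicit.
Unset Printing Implicit Defensive.

(** Two facts about the presentation carry the proof.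

    The first is a length bound ([linear_prefix_products]): for some constant c,
    if a product of k proper non-empty prefixes of the relator is represented by
    a word u, then k is at most c times the length of u.  It gives a linear upper
    distortion function for the prefix monoid ([prefix_monoid_linear_distortion]).
    It is detected in a quotient of the group.  For the non-orientable groups of
    genus g > 1 the quotient is Z: a_1 goes to g - 1 and the other generators to
    -1, and the relator then has positive weight on all its proper non-empty
    prefixes ([nonorientable_linear]).  The torus is handled by a, b -> 1
    ([torus_linear]).  For orientable genus g > 1 the prefix [a_1,b_1] dies in
    every abelian quotient, and the free group on a and b takes over: a_1, b_1 go
    to a, b, the last pair a_g, b_g goes to b, a and all other generators to 1,
    so that the relator becomes [a,b][b,a].  Each proper prefix then becomes one
    of a, ab, aba^-1, [a,b], and in a product of these the reduced word gains a
    positive letter at least every second factor ([commutator_linear]).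

    The second is the word problem.  A right-angled Coxeter group has an easy
    one: insert the letters one by one, cancelling each against an equal letter
    that it can be commuted to ([coxeter_eq_nil]).  The orientable group of genus
    g and the non-orientable group of genus g embed in the reflection groups of
    the right-angled polygons with 2g + 2 and g + 2 sides.  In the non-orientable
    case, write z, p_0, ..., p_g for the reflections in the sides, in cyclic
    order.  Neighbours commute, hence (p_j z p_(j+1))^2 =
    (p_j z)^2 (p_(j+1) z)^-2, and the images p_j z p_(j+1) of the generators
    satisfy the surface relation by telescoping.  The orientable case is similar,
    with one more mirror q_j between p_j and p_(j+1).  Injectivity comes from an
    explicit action of the reflection group on four copies of the surface group,
    the action induced from the subgroup of index four that the surface group is
    ([coxeter_embedding]).

    Together they decide membership of u in the prefix monoid: only products of
    at most c |u| prefixes have to be compared with u ([in_prefix_monoidP]).  To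
    see that this procedure is a recursive function, the class [recursive] is
    first shown to be closed under the usual list-processing constructions. *)

(** * Closure properties of the recursive functions *)

Definition recursive1 (f : nat -> nat) := recursive (fun v : 1.-tuple nat => f (thead v)).
Definition recursive2 (f : nat -> nat -> nat) :=
  recursive (fun v : 2.-tuple nat => f (tnth v ord0) (tnth v ord_max)).
Definition recursive3 (f : nat -> nat -> nat -> nat) :=
  recursive (fun v : 3.-tuple nat => f (tnth v ord0) (tnth v (inord 1)) (tnth v ord_max)).

Lemma rec_ext k (f g : k.-tuple nat -> nat) :
  f =1 g -> recursive f -> recursive g.
Proof. by move=> /funext ->. Qed.

Lemma rec_comp1 k f (h : k.-tuple nat -> nat) :
  recursive1 f -> recursive h -> recursive (fun v => f (h v)).
Proof.
move=> Rf Rh; apply: rec_ext (rec_comp Rf (fun=> Rh)) => v.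
by rewrite /thead tnth_mktuple.
Qed.

Lemma rec_comp2 k f (h1 h2 : k.-tuple nat -> nat) :
  recursive2 f -> recursive h1 -> recursive h2 -> recursive (fun v => f (h1 v) (h2 v)).
Proof.
move=> Rf Rh1 Rh2.
have Rh (i : 'I_2) : recursive (if i == ord0 then h1 else h2) by case: ifP.
by apply: rec_ext (rec_comp Rf Rh) => v; rewrite !tnth_mktuple.
Qed.

Lemma recursive1_ext f g : f =1 g -> recursive1 f -> recursive1 g.
Proof. by move=> /funext ->. Qed.

Lemma recursive1_comp f g : recursive1 f -> recursive1 g -> recursive1 (fun x => f (g x)).
Proof. exact: rec_comp1. Qed.

Lemma recursive1_comp2 f g h : recursive2 f -> recursive1 g -> recursive1 h ->
  recursive1 (fun x => f (g x) (h x)).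
Proof. exact: rec_comp2. Qed.

Lemma recursive1_id : recursive1 id.
Proof. exact: rec_proj. Qed.

Lemma recursive1_succ : recursive1 succn.
Proof. exact: rec_succ. Qed.

Lemma recursive1_const n : recursive1 (fun=> n).
Proof.
by elim: n => [|n IH]; [exact: rec_zero|exact: recursive1_comp recursive1_succ IH].
Qed.

Lemma recursive2_prim f s h : recursive1 f -> recursive3 s -> (forall x, h 0 x = f x) ->
  (forall n x, h n.+1 x = s n (h n x) x) -> recursive2 h.
Proof.
move=> Rf Rs h0 hS; apply: (rec_prim Rf Rs) => [v|n v].
  by rewrite (tnth_nth 0) (tnth_nth 0) /= h0 /thead (tnth_nth 0).
by rewrite !(tnth_nth 0) /= inordK //= hS.
Qed.

Lemma recursive1_prim a s h : recursive2 s -> h 0 = a ->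
  (forall n, h n.+1 = s n (h n)) -> recursive1 h.
Proof.
move=> Rs h0 hS; have Rh : recursive2 (fun n _ => h n).
  apply: (recursive2_prim (recursive1_const a) (s := fun n y _ => s n y)) => //.
  by apply: rec_comp2 Rs _ _; apply: rec_proj.
exact: (recursive1_comp2 Rh recursive1_id recursive1_id).
Qed.

Lemma recursive1_pred : recursive1 predn.
Proof. by apply: (@recursive1_prim 0 (fun n _ => n)) => //; apply: rec_proj. Qed.

Lemma recursive2_add : recursive2 addn.
Proof.
apply: (@recursive2_prim id (fun _ y _ => y.+1)) => //; first exact: recursive1_id.
by apply: rec_comp1 recursive1_succ _; apply: rec_proj.
Qed.

Lemma recursive2_sub : recursive2 subn.
Proof.
have Rr : recursive2 (fun n x => x - n).
  apply: (@recursive2_prim id (fun _ y _ => y.-1)) => [||x|n x]; rewrite ?subn0 ?subnS //.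
    exact: recursive1_id.
  by apply: rec_comp1 recursive1_pred _; apply: rec_proj.
by apply: (rec_comp2 Rr); apply: rec_proj.
Qed.

Definition triangle n := 'C(n.+1, 2).

Lemma triangleS n : triangle n.+1 = triangle n + n.+1.
Proof. by rewrite /triangle binS bin1 addnC. Qed.

Lemma leq_triangle m n : m <= n -> triangle m <= triangle n.
Proof.
move=> /subnK <-; elim: (n - m) => // d IH.
by rewrite addSn triangleS (leq_trans IH) // leq_addr.
Qed.

Lemma recursive1_triangle : recursive1 triangle.
Proof.
apply: (@recursive1_prim 0 (fun n y => y + n.+1)) => [||n]; rewrite ?triangleS //.
apply: (rec_comp2 recursive2_add); first exact: rec_proj.
by apply: rec_comp1 recursive1_succ _; apply: rec_proj.
Qed.

Lemma triangle_unbounded n : exists s, n < triangle s.+1.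
Proof. by exists n; rewrite triangleS leq_addl. Qed.

(** The pairing function enumerates the plane along anti-diagonals.  The index of
    the anti-diagonal of n is found by unbounded search, which is where
    minimisation enters; all else is primitive recursion. *)
Definition diagonal n := ex_minn (triangle_unbounded n).
Definition cantor_pair x y := triangle (x + y) + x.
Definition cantor_fst n := n - triangle (diagonal n).
Definition cantor_snd n := diagonal n - cantor_fst n.

Lemma diagonal_cantor_pair x y : diagonal (cantor_pair x y) = x + y.
Proof.
rewrite /diagonal; case: ex_minnP => s lt_s min_s; apply/eqP.
rewrite eqn_leq min_s; last by rewrite /cantor_pair triangleS ltn_add2l ltnS leq_addr.
rewrite leqNgt; apply/negP => /leq_triangle; apply/negP; rewrite -ltnNge.
by apply: leq_ltn_trans lt_s; apply: leq_addr.
Qed.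

Lemma cantor_fst_pair x y : cantor_fst (cantor_pair x y) = x.
Proof. by rewrite /cantor_fst diagonal_cantor_pair addKn. Qed.

Lemma cantor_snd_pair x y : cantor_snd (cantor_pair x y) = y.
Proof. by rewrite /cantor_snd cantor_fst_pair diagonal_cantor_pair addKn. Qed.

Lemma recursive1_diagonal : recursive1 diagonal.
Proof.
apply: (@rec_mu _ (fun v : 2.-tuple nat =>
   (tnth v ord_max).+1 - triangle (tnth v ord0).+1)).
- apply: (rec_comp2 recursive2_sub).
    by apply: (rec_comp1 recursive1_succ); apply: rec_proj.
  by apply: (rec_comp1 (recursive1_comp recursive1_triangle recursive1_succ)); apply: rec_proj.
- move=> v; rewrite !(tnth_nth 0) /= /thead !(tnth_nth 0) /diagonal /=.
  by case: ex_minnP => s lt_s _; apply/eqP; rewrite subn_eq0.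
- move=> v m; rewrite !(tnth_nth 0) /= /thead !(tnth_nth 0) /diagonal /=.
  case: ex_minnP => s _ min_s; rewrite subn_eq0; apply: contraTN => /min_s.
  by rewrite -leqNgt.
Qed.

Lemma recursive1_cantor_pair f g : recursive1 f -> recursive1 g ->
  recursive1 (fun x => cantor_pair (f x) (g x)).
Proof.
move=> Rf Rg; apply: (recursive1_comp2 recursive2_add) => //.
by apply: (recursive1_comp recursive1_triangle); apply: (recursive1_comp2 recursive2_add).
Qed.

Lemma recursive1_cantor_fst : recursive1 cantor_fst.
Proof.
apply: (recursive1_comp2 recursive2_sub recursive1_id).
exact: recursive1_comp recursive1_triangle recursive1_diagonal.
Qed.

Lemma recursive1_cantor_snd : recursive1 cantor_snd.
Proof. exact: (recursive1_comp2 recursive2_sub recursive1_diagonal recursive1_cantor_fst). Qed.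

(** Parameters of an iteration travel inside the argument of the iterated
    function, so that unary functions suffice from here on. *)
Lemma recursive1_iter N S I : recursive1 N -> recursive1 S -> recursive1 I ->
  recursive1 (fun x => iter (N x) (fun r => S (cantor_pair r x)) (I x)).
Proof.
move=> RN RS RI.
have Rh : recursive2 (fun n x => iter n (fun r => S (cantor_pair r x)) (I x)).
  apply: (recursive2_prim RI (s := fun _ y x => S (cantor_pair y x))) => //.
  apply: (rec_comp1 RS); apply: (rec_comp2 recursive2_add); last exact: rec_proj.
  by apply: (rec_comp1 recursive1_triangle); apply: (rec_comp2 recursive2_add); exact: rec_proj.
exact: (recursive1_comp2 Rh RN recursive1_id).
Qed.

Lemma recursive1_case N f g : recursive1 N -> recursive1 f -> recursive1 g ->
  recursive1 (fun x => if N x == 0 then f x else g x).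
Proof.
move=> RN Rf Rg.
apply: recursive1_ext (recursive1_iter RN (recursive1_comp Rg recursive1_cantor_snd) Rf) => x.
by case: (N x) => //= n; rewrite cantor_snd_pair.
Qed.

(** * Computable functions between encoded types *)

(** A code for every type that occurs in the decision procedure.  The instance for
    finite types has low priority, so that booleans and pairs keep the codes that
    the closure lemmas refer to. *)
Class encodable (T : Type) := code : T -> nat.
#[local] Instance nat_encodable : encodable nat := id.
#[local] Instance bool_encodable : encodable bool := nat_of_bool.
#[local] Instance fin_encodable (T : finType) : encodable T | 10 :=
  fun x => enum_rank x.
#[local] Instance prod_encodable A B `{encodable A} `{encodable B} :
  encodable (A * B)%type := fun p => cantor_pair (code p.1) (code p.2).
Fixpoint seq_code A `{encodable A} (s : seq A) : nat :=
  if s is x :: s' then (cantor_pair (code x) (seq_code s')).+1 else 0.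
#[local] Instance seq_encodable A `{encodable A} : encodable (seq A) := @seq_code A _.

Definition computable A B `{encodable A} `{encodable B} (f : A -> B) :=
  exists2 F, recursive1 F & forall x, F (code x) = code (f x).

Section Computable.
Context {A B C D : Type} {cA : encodable A} {cB : encodable B}
  {cC : encodable C} {cD : encodable D}.

Lemma computable_ext (f g : A -> B) : f =1 g -> computable f -> computable g.
Proof. by move=> /funext ->. Qed.

Lemma computable_id : computable (@id A).
Proof. by exists id => //; apply: recursive1_id. Qed.

Lemma computable_comp (g : B -> C) (f : A -> B) :
  computable g -> computable f -> computable (fun x => g (f x)).
Proof.
move=> [G RG GE] [F RF FE]; exists (fun x => G (F x)); first exact: recursive1_comp.
by move=> x; rewrite FE GE.
Qed.

Lemma computable_const (b : B) : computable (fun _ : A => b).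
Proof. by exists (fun=> code b) => //; apply: recursive1_const. Qed.

Lemma computable_pair (f : A -> B) (g : A -> C) :
  computable f -> computable g -> computable (fun x => (f x, g x)).
Proof.
move=> [F RF FE] [G RG GE]; exists (fun x => cantor_pair (F x) (G x)).
  exact: recursive1_cantor_pair.
by move=> x; rewrite FE GE.
Qed.

Lemma computable_fst (f : A -> B * C) : computable f -> computable (fun x => (f x).1).
Proof.
move=> [F RF FE]; exists (fun x => cantor_fst (F x)).
  exact: recursive1_comp recursive1_cantor_fst RF.
by move=> x; rewrite FE cantor_fst_pair.
Qed.

Lemma computable_snd (f : A -> B * C) : computable f -> computable (fun x => (f x).2).
Proof.
move=> [F RF FE]; exists (fun x => cantor_snd (F x)).
  exact: recursive1_comp recursive1_cantor_snd RF.
by move=> x; rewrite FE cantor_snd_pair.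
Qed.

Lemma computable_iter (n : A -> nat) (s : B * A -> B) (i : A -> B) :
  computable n -> computable s -> computable i ->
  computable (fun x => iter (n x) (fun r => s (r, x)) (i x)).
Proof.
move=> [N RN NE] [S RS SE] [I RI IE].
exists (fun x => iter (N x) (fun r => S (cantor_pair r x)) (I x)); first exact: recursive1_iter.
move=> x; rewrite NE IE /code /nat_encodable; elim: (n x) => //= k ->.
exact: (SE (_, x)).
Qed.

Lemma computable_if (b : A -> bool) (f g : A -> B) :
  computable b -> computable f -> computable g ->
  computable (fun x => if b x then f x else g x).
Proof.
move=> [N RN NE] [F RF FE] [G RG GE].
exists (fun x => if N x == 0 then G x else F x); first exact: recursive1_case RN RG RF.
by move=> x; rewrite NE FE GE; case: (b x).
Qed.

Lemma computable_nilp (f : A -> seq B) :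
  computable f -> computable (fun x => nilp (f x)).
Proof.
move=> [F RF FE]; exists (fun x => if F x == 0 then 1 else 0).
  by apply: recursive1_case => //; apply: recursive1_const.
by move=> x; rewrite FE; case: (f x).
Qed.

Lemma computable_cons (f : A -> B) (g : A -> seq B) :
  computable f -> computable g -> computable (fun x => f x :: g x).
Proof.
move=> [F RF FE] [G RG GE]; exists (fun x => (cantor_pair (F x) (G x)).+1).
  exact: recursive1_comp recursive1_succ (recursive1_cantor_pair RF RG).
by move=> x; rewrite FE GE.
Qed.

(** A function of a finite argument is a finite table of computable functions,
    whatever the table is. *)
Lemma computable_fin (T : finType) (f : T -> A -> B) (t : A -> T) :
  (forall i, computable (f i)) -> computable t -> computable (fun x => f (t x) x).
Proof.
move=> cf [N RN NE].
have [F FP] : {F : T -> nat -> nat |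
    forall i, recursive1 (F i) /\ forall x, F i (code x) = code (f i x)}.
  by apply: cid; have [F FP] := choice (fun i =>
    let: ex_intro2 F RF FE := cf i in ex_intro _ F (conj RF FE)); exists F.
exists (fun x => nth (fun=> 0) [seq F i | i <- enum T] (N x) x); last first.
  move=> x; rewrite NE /code /fin_encodable (nth_map (t x)); last first.
    by rewrite -cardE ltn_ord.
  by rewrite nth_enum_rank; have [_ ->] := FP (t x).
elim: (enum T) N RN {NE} => [|i e IH] N RN.
  by apply: recursive1_ext (recursive1_const 0) => x; rewrite nth_nil.
have RN' := recursive1_comp recursive1_pred RN.
apply: recursive1_ext (recursive1_case RN (FP i).1 (IH _ RN')) => x.
by case: (N x).
Qed.

Lemma size_leq_code (s : seq B) : size s <= code s.
Proof.
elim: s => //= x s IH; rewrite ltnS (leq_trans IH) // /cantor_pair.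
have leqtri n : n <= triangle n by case: n => // n; rewrite triangleS leq_addl.
by rewrite (leq_trans _ (leq_addr _ _)) // (leq_trans _ (leqtri _)) ?leq_addl.
Qed.

Lemma computable_foldl (s : A -> seq B) (h : (C * B) * A -> C) (i : A -> C) :
  computable s -> computable h -> computable i ->
  computable (fun x => foldl (fun c b => h ((c, b), x)) (i x) (s x)).
Proof.
move=> [S RS SE] [H RH HE] [I RI IE].
(* On the code of ((l, c), x): pop the head b of the list coded by l and replace
   c by h ((c, b), x).  Steps taken after the list is exhausted change nothing,
   so the code of the list, which exceeds its length, serves as step count. *)
pose step n := if cantor_fst (cantor_fst n) == 0 then cantor_fst n else
  let lst := (cantor_fst (cantor_fst n)).-1 in
  cantor_pair (cantor_snd lst)
    (H (cantor_pair (cantor_pair (cantor_snd (cantor_fst n)) (cantor_fst lst))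
       (cantor_snd n))).
have Rstep : recursive1 step.
  have R1ff : recursive1 (fun n => (cantor_fst (cantor_fst n)).-1).
    apply: (recursive1_comp recursive1_pred).
    exact: recursive1_comp recursive1_cantor_fst recursive1_cantor_fst.
  apply: recursive1_case; try exact: recursive1_cantor_fst.
    exact: recursive1_comp recursive1_cantor_fst recursive1_cantor_fst.
  apply: recursive1_cantor_pair; first exact: recursive1_comp recursive1_cantor_snd R1ff.
  apply: (recursive1_comp RH); apply: recursive1_cantor_pair recursive1_cantor_snd.
  apply: recursive1_cantor_pair.
    exact: recursive1_comp recursive1_cantor_snd recursive1_cantor_fst.
  exact: recursive1_comp recursive1_cantor_fst R1ff.
exists (fun x => cantor_snd
    (iter (S x) (fun r => step (cantor_pair r x)) (cantor_pair (S x) (I x)))).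
  apply: (recursive1_comp recursive1_cantor_snd); apply: recursive1_iter => //.
  exact: recursive1_cantor_pair.
move=> x; rewrite SE IE.
have fold n (l : seq B) (c : C) : size l <= n ->
    iter n (fun r => step (cantor_pair r (code x))) (cantor_pair (code l) (code c)) =
    cantor_pair 0 (code (foldl (fun c b => h ((c, b), x)) c l)); last first.
  by rewrite (fold _ _ _ (size_leq_code _)) cantor_snd_pair.
elim: n l c => [|n IH] [|b l] c // ln; rewrite iterSr {2}/step.
  by rewrite !cantor_fst_pair eqxx; apply: IH.
rewrite -[code (b :: l)]/(cantor_pair (code b) (code l)).+1.
rewrite !(cantor_fst_pair, cantor_snd_pair) /=.
by rewrite (HE ((c, b), x)) IH.
Qed.

End Computable.

Ltac solve_projection :=
  cbv beta;
  lazymatch goal with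
  | |- @computable _ _ _ _ (fun x => x) => exact: computable_id
  | |- @computable _ _ _ _ fst => exact: (computable_fst computable_id)
  | |- @computable _ _ _ _ snd => exact: (computable_snd computable_id)
  | |- @computable _ _ _ _ (fun x => fst (@?f x)) =>
    apply: (@computable_fst _ _ _ _ _ _ f); solve_projection
  | |- @computable _ _ _ _ (fun x => snd (@?f x)) =>
    apply: (@computable_snd _ _ _ _ _ _ f); solve_projection
  end.

Section ComputableSeq.
Context {A B C : Type} {cA : encodable A} {cB : encodable B} {cC : encodable C}.

Lemma computable_rev (s : A -> seq B) : computable s -> computable (fun x => rev (s x)).
Proof.
move=> cs; apply: computable_ext (computable_foldl (h := fun q => q.1.2 :: q.1.1) cs _
  (computable_const [::])) => [x|].
  suff fold (l acc : seq B) :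
      foldl (fun c b => b :: c) acc l = catrev l acc by rewrite /= fold.
  by elim: l acc => //= b l IH acc; rewrite IH.
by apply: computable_cons; solve_projection.
Qed.

Lemma computable_foldr (s : A -> seq B) (h : B * C * A -> C) (i : A -> C) :
  computable s -> computable h -> computable i ->
  computable (fun x => foldr (fun b c => h ((b, c), x)) (i x) (s x)).
Proof.
move=> cs ch ci; apply: computable_ext (computable_foldl
  (h := fun q => h ((q.1.2, q.1.1), q.2)) (computable_rev cs) _ ci) => [x|].
  by rewrite foldl_rev.
apply: (computable_comp ch).
by apply: computable_pair; [apply: computable_pair|]; solve_projection.
Qed.

Lemma computable_cat_const (t : seq B) (s : A -> seq B) :
  computable s -> computable (fun x => t ++ s x).
Proof.
move=> cs; elim: t => [|b t IH] //; exact: computable_cons (computable_const b) IH.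
Qed.

End ComputableSeq.

Lemma recursive1_modn c : 0 < c -> recursive1 (modn^~ c).
Proof.
move=> c0; apply: (@recursive1_prim 0 (fun _ y => if c - y.+1 == 0 then 0 else y.+1)).
- have ry : recursive (fun v : 2.-tuple nat => tnth v ord_max).
    exact: rec_proj.
  apply: (rec_comp1 _ ry (f := fun y => if c - y.+1 == 0 then 0 else y.+1)).
  apply: (recursive1_case (N := fun y => c - y.+1)); last exact: recursive1_succ;
    last exact: recursive1_const.
  exact: (recursive1_comp2 recursive2_sub (recursive1_const c) recursive1_succ).
- exact: mod0n.
- move=> n; rewrite modnS subn_eq0 leq_eqVlt ltnS (leqNgt c) ltn_pmod // orbF.
  have ->// : (c %| n.+1) = (c == (n %% c).+1).
  rewrite /dvdn -addn1 -modnDml addn1.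
  have := ltn_pmod n c0; rewrite leq_eqVlt => /orP[/eqP->|lt].
    by rewrite modnn !eqxx.
  by rewrite modn_small //= eq_sym; symmetry; apply/negbTE; rewrite neq_ltn lt orbT.
Qed.

Lemma recursive1_divn c : 0 < c -> recursive1 (divn^~ c).
Proof.
move=> c0; apply: (@recursive1_prim 0 (fun n y => y + (if n.+1 %% c == 0 then 1 else 0))).
- apply: (rec_comp2 recursive2_add); first exact: rec_proj.
  have rn : recursive (fun v : 2.-tuple nat => tnth v ord0) by exact: rec_proj.
  apply: (rec_comp1 _ rn (f := fun n => if n.+1 %% c == 0 then 1 else 0)).
  apply: (recursive1_case (N := fun n => n.+1 %% c)); try exact: recursive1_const.
  exact: recursive1_comp (recursive1_modn c0) recursive1_succ.
- exact: div0n.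
- by move=> n; rewrite divnS // /dvdn addnC; case: ifP.
Qed.

(** Translation of the bijective base-#|T| numeration into the list codes.  Reading
    digits from the least significant one reverses the word. *)
Lemma recursive1_decode (T : finType) :
  exists2 F, recursive1 F & forall u : seq T, F (word_code u) = code (rev u).
Proof.
case: (posnP #|T|) => [T0|T_gt0].
  exists (fun=> 0) => [|[|x u]//]; first exact: recursive1_const.
  by have := ltn_ord (enum_rank x); rewrite {2}T0.
pose step n := if cantor_fst n == 0 then n else
  cantor_pair ((cantor_fst n).-1 %/ #|T|)
    (cantor_pair ((cantor_fst n).-1 %% #|T|) (cantor_snd n)).+1.
have Rpred : recursive1 (fun n => (cantor_fst n).-1).
  exact: recursive1_comp recursive1_pred recursive1_cantor_fst.
have Rstep : recursive1 step.
  apply: recursive1_case; [exact: recursive1_cantor_fst|exact: recursive1_id|].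
  apply: recursive1_cantor_pair.
    exact: recursive1_comp (recursive1_divn T_gt0) Rpred.
  apply: (recursive1_comp recursive1_succ); apply: recursive1_cantor_pair recursive1_cantor_snd.
  exact: recursive1_comp (recursive1_modn T_gt0) Rpred.
exists (fun n => cantor_snd
    (iter n (fun r => step (cantor_fst (cantor_pair r n))) (cantor_pair n 0))).
  apply: (recursive1_comp recursive1_cantor_snd).
  apply: (recursive1_iter recursive1_id (recursive1_comp Rstep recursive1_cantor_fst)).
  exact: (recursive1_cantor_pair recursive1_id (recursive1_const 0)).
move=> u; have le_code : size u <= word_code u.
  elim: u => //= x u IH; rewrite addnS ltnS (leq_trans IH) //.
  by rewrite (leq_trans _ (leq_addr _ _)) // leq_pmull.
have fold m n (l acc : seq T) : size l <= n ->
    iter n (fun r => step (cantor_fst (cantor_pair r m)))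
      (cantor_pair (word_code l) (code acc)) =
    cantor_pair 0 (code (catrev l acc)); last first.
  by rewrite (fold _ _ u [::] le_code) cantor_snd_pair.
elim: n l acc => [|n IH] [|x l] acc // ln; rewrite iterSr {2}/step cantor_fst_pair.
  by rewrite cantor_fst_pair eqxx; apply: IH.
rewrite cantor_fst_pair cantor_snd_pair /= addnS /= mulnC divnMDl // divn_small //.
rewrite addn0 modnMDl modn_small //; exact: (IH l (x :: acc)).
Qed.

Lemma computable_decidable (T : finType) (f : seq T -> bool) (L : seq T -> Prop) :
  (forall u, f u <-> L u) -> computable f -> decidable_language L.
Proof.
move=> fL cf.
have [G RG GE] := computable_comp cf (computable_rev (@computable_id (seq T) _)).
have [F RF FE] := recursive1_decode T; exists (fun v => G (F (thead v))).
  exact: recursive1_comp RG RF.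
move=> u; rewrite /thead (tnth_nth 0) /= FE GE revK.
by case: asboolP => [/fL ->|Lu] //; case fu: (f u) => //; case: Lu; apply/fL.
Qed.

(** * Word problem in right-angled Coxeter groups *)

Section RightAngledCoxeter.
Variables (I : finType) (comm : rel I).
Hypotheses (comm_sym : symmetric comm) (comm_irr : irreflexive comm).
Implicit Types (s t x y : I) (l u v : seq I).

(** Equality in the group generated by I with the relations s^2 = 1, and st = ts
    when s and t are related by comm. *)
Inductive coxeter_eq : seq I -> seq I -> Prop :=
| coxeter_eq_refl u : coxeter_eq u u
| coxeter_eq_sym u v : coxeter_eq u v -> coxeter_eq v u
| coxeter_eq_trans v u u' : coxeter_eq u v -> coxeter_eq v u' -> coxeter_eq u u'
| coxeter_eq_sq u s v : coxeter_eq (u ++ [:: s; s] ++ v) (u ++ v)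
| coxeter_eq_swap u s t v : comm s t ->
    coxeter_eq (u ++ [:: s; t] ++ v) (u ++ [:: t; s] ++ v).

Lemma coxeter_eq_cat u u' v v' :
  coxeter_eq u u' -> coxeter_eq v v' -> coxeter_eq (u ++ v) (u' ++ v').
Proof.
move=> uu' vv'; apply: (@coxeter_eq_trans (u' ++ v)).
  elim: uu' => {u u'} [u|u u' _|u1 u u2 _ IH1 _ IH2|u s u'|u s t u' st].
  - exact: coxeter_eq_refl.
  - exact: coxeter_eq_sym.
  - exact: coxeter_eq_trans IH1 IH2.
  - by rewrite -!catA; apply: coxeter_eq_sq.
  - by rewrite -!catA; apply: coxeter_eq_swap.
elim: vv' => {v v'} [v|v v' _|v1 v v2 _ IH1 _ IH2|v s v'|v s t v' st].
- exact: coxeter_eq_refl.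
- exact: coxeter_eq_sym.
- exact: coxeter_eq_trans IH1 IH2.
- by rewrite !(catA u'); apply: coxeter_eq_sq.
- by rewrite !(catA u'); apply: coxeter_eq_swap.
Qed.

Lemma coxeter_eq_catV u : coxeter_eq (u ++ rev u) [::].
Proof.
elim: u => [|s u IH]; first exact: coxeter_eq_refl.
have -> : (s :: u) ++ rev (s :: u) = [:: s] ++ (u ++ rev u) ++ [:: s].
  by rewrite rev_cons -cats1 -catA.
apply: coxeter_eq_trans (coxeter_eq_sq [::] s [::]).
apply: (coxeter_eq_cat (coxeter_eq_refl [:: s])).
exact: (coxeter_eq_cat IH (coxeter_eq_refl [:: s])).
Qed.

(** The word $(xz)^2(yz)^{-2}$, in the form that the images of both surface
    relators telescope to. *)
Definition square_ratio x z y := [:: x; z; x; z; z; y; z; y].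

Lemma square_ratio_id x z : coxeter_eq (square_ratio x z x) [::].
Proof. exact: (coxeter_eq_catV [:: x; z; x; z]). Qed.

Lemma square_ratio_comm x z y :
  comm x z -> comm y z -> coxeter_eq (square_ratio x z y) [::].
Proof.
move=> xz yz.
apply: coxeter_eq_trans (coxeter_eq_swap [::] [:: x; z; z; y; z; y] xz) _.
apply: coxeter_eq_trans (coxeter_eq_sq [:: z] x [:: z; z; y; z; y]) _.
apply: coxeter_eq_trans (coxeter_eq_sq [::] z [:: z; y; z; y]) _.
apply: coxeter_eq_trans (coxeter_eq_swap [:: z] [:: y] yz) _.
apply: coxeter_eq_trans (coxeter_eq_sq [::] z [:: y; y]) _.
exact: (coxeter_eq_sq [::] y [::]).
Qed.

(** Right multiplication by s of a word whose letters are listed from last to first.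
    If s cannot cancel, it is placed below the letters that it commutes with,
    instead of on top; this is harmless and keeps the recursion structural. *)
Fixpoint insert s l :=
  if l is t :: l' then
    if t == s then l' else if comm s t then t :: insert s l' else s :: l
  else [:: s].

Fixpoint cancels s l :=
  if l is t :: l' then (t == s) || comm s t && cancels s l' else false.

Fixpoint reduced l := if l is t :: l' then ~~ cancels t l' && reduced l' else true.

Lemma comm_neq s t : comm s t -> (t == s) = false.
Proof. by apply: contraTF => /eqP->; rewrite comm_irr. Qed.

Lemma comm_pred2 s t x y :
  comm s t -> ~~ comm x y -> pred2 x y s -> pred2 x y t = false.
Proof.
move=> st nxy sxy; apply/negP => txy; move: sxy txy st nxy.
by move=> /orP[] /eqP-> /orP[] /eqP->; rewrite ?comm_irr // 1?comm_sym => ->.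
Qed.

(** The subwords on pairs of non-commuting letters determine a word up to
    commutations.  Comparing them turns statements up to commutation into plain
    equalities. *)
Definition projection x y l := filter (pred2 x y) l.
Definition same_projections l l' :=
  forall x y, ~~ comm x y -> projection x y l = projection x y l'.

(** The letters that block s are seen in the projections to s and a letter y not
    commuting with s; the case y = s excludes words in which s does not occur. *)
Lemma cancels_projection s l :
  cancels s l <-> forall y, ~~ comm s y -> ohead (projection s y l) = Some s.
Proof.
elim: l => [|t l IH] /=; first by split=> // /(_ s); rewrite comm_irr => /(_ isT).
have [-> /=|ts /=] := eqVneq t s; first by split=> // _ y _; rewrite eqxx.
have [st|nst] /= := boolP (comm s t).
  have ->// : (forall y, ~~ comm s y ->
      ohead (if t == y then t :: projection s y l else projection s y l) = Some s) <->
      forall y, ~~ comm s y -> ohead (projection s y l) = Some s.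
  by split=> H y ny; have := H y ny; (have /negbTE -> : t != y by
     apply: contraNneq ny => <-).
split=> // /(_ t nst); rewrite eqxx => -[] ts'; by rewrite ts' eqxx in ts.
Qed.

Lemma cancels_same_projections s l l' :
  (forall y, ~~ comm s y -> projection s y l = projection s y l') ->
  cancels s l = cancels s l'.
Proof.
move=> E; apply/idP/idP => /cancels_projection H; apply/cancels_projection => y ny;
  by [rewrite -E // H|rewrite E // H].
Qed.

Lemma projection_insert s x y l : ~~ comm x y ->
  if cancels s l
  then projection x y l = (if pred2 x y s then cons s else id) (projection x y (insert s l))
  else projection x y (insert s l) = (if pred2 x y s then cons s else id) (projection x y l).
Proof.
move=> nxy; elim: l => [|t l IH] /=; first by case: ifP.
have [-> /=|ts /=] := eqVneq t s; first by case: ifP.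
have [st|nst] /= := boolP (comm s t); last by case: ifP.
have H : pred2 x y s -> pred2 x y t = false.
  exact: comm_pred2 st nxy.
by move: H IH => /=; case: (_ || _) => [->|_] //; case: ifP => _ ->.
Qed.

Lemma projection_insert_commuting s t y l : comm s t -> ~~ comm t y ->
  projection t y (insert s l) = projection t y l.
Proof.
move=> st nty; have := projection_insert s l nty.
have -> : pred2 t y s = false.
  rewrite /= eq_sym comm_neq //=; apply/negbTE; apply: contraNneq nty => <-.
  by rewrite comm_sym.
by case: ifP => _ ->.
Qed.

Lemma cancels_insert_commuting s t l : comm s t -> cancels t (insert s l) = cancels t l.
Proof.
move=> st; apply: cancels_same_projections => y.
exact: projection_insert_commuting.
Qed.

Lemma reduced_insert s l : reduced l -> reduced (insert s l).
Proof.
elim: l => //= t l IH /andP[nt rl]; case: eqVneq => // ts.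
have [st|nst] := boolP (comm s t); first by rewrite /= cancels_insert_commuting // nt IH.
by rewrite /= (negbTE ts) (negbTE nst) /= nt.
Qed.

Lemma cancels_insert s l : reduced l -> cancels s (insert s l) = ~~ cancels s l.
Proof.
elim: l => [|t l IH] /=; first by rewrite eqxx.
case/andP=> nt rl; case: eqVneq => [ts|ts] /=; first by rewrite -ts; apply/negbTE.
have [st|nst] /= := boolP (comm s t); last by rewrite eqxx.
by rewrite (negbTE ts) st IH.
Qed.

(** In a reduced word, cancelling s uncovers no second s, so that the second
    insertion undoes the first one. *)
Lemma insert_insert s l : reduced l -> same_projections (insert s (insert s l)) l.
Proof.
move=> rl x y nxy; have := projection_insert s (insert s l) nxy.
have := projection_insert s l nxy.
rewrite cancels_insert //; case: (cancels s l) => /=; last by move=> ->; case: ifP => _ // [].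
by move=> -> ->.
Qed.

Lemma insert_swap s t l : comm s t ->
  same_projections (insert s (insert t l)) (insert t (insert s l)).
Proof.
move=> st x y nxy; have ts : comm t s by rewrite comm_sym.
have neut r k : ~~ pred2 x y r -> projection x y (insert r k) = projection x y k.
  by move=> /negbTE rxy; have := projection_insert r k nxy; rewrite rxy; case: ifP => _ ->.
have [sxy|/neut Es] := boolP (pred2 x y s); last first.
  rewrite Es; have := projection_insert t l nxy; have := projection_insert t (insert s l) nxy.
  rewrite cancels_insert_commuting // Es; case: (cancels t l); last by move=> -> ->.
  by case: ifP => _ -> // [].
have /neut Et : ~~ pred2 x y t.
  by rewrite (comm_pred2 st nxy sxy).
rewrite Et; have := projection_insert s l nxy; have := projection_insert s (insert t l) nxy.
rewrite cancels_insert_commuting // Et sxy; case: (cancels s l) => -> //=.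
by case.
Qed.

Lemma same_projections_insert s l l' :
  same_projections l l' -> same_projections (insert s l) (insert s l').
Proof.
move=> E x y nxy; have := projection_insert s l nxy; have := projection_insert s l' nxy.
rewrite -(cancels_same_projections (E s)) -(E _ _ nxy); case: (cancels s l); case: ifP => _ /=.
- by move=> -> [].
- by move=> -> .
- by move=> -> ->.
- by move=> -> ->.
Qed.

Lemma same_projections_nil l : same_projections l [::] -> l = [::].
Proof.
by case: l => // x l /(_ x x); rewrite comm_irr /= eqxx => /(_ isT).
Qed.

Definition insert_word l u := foldl (fun l s => insert s l) l u.

Lemma reduced_insert_word l u : reduced l -> reduced (insert_word l u).
Proof. by elim: u l => //= s u IH l rl; apply/IH/reduced_insert. Qed.

Lemma same_projections_insert_word l l' u :
  same_projections l l' -> same_projections (insert_word l u) (insert_word l' u).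
Proof. by elim: u l l' => //= s u IH l l' E; apply/IH/same_projections_insert. Qed.

Lemma coxeter_eq_insert_word u v l : coxeter_eq u v -> reduced l ->
  same_projections (insert_word l u) (insert_word l v).
Proof.
move=> uv rl; elim: uv => {u v} [u|u v _ IH|v u t _ IH1 _ IH2|u s v|u s t v st].
- by [].
- by move=> x y nxy; rewrite IH.
- by move=> x y nxy; rewrite IH1 // IH2.
- rewrite /insert_word !foldl_cat -/(insert_word l u) -/(insert_word _ v).
  exact/same_projections_insert_word/insert_insert/reduced_insert_word.
- rewrite /insert_word !foldl_cat -/(insert_word l u) -/(insert_word _ v).
  by apply/same_projections_insert_word/insert_swap; rewrite comm_sym.
Qed.

Lemma coxeter_eq_insert s l : coxeter_eq (rev (insert s l)) (rev l ++ [:: s]).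
Proof.
elim: l => [|t l IH]; first exact: coxeter_eq_refl.
rewrite /=; case: eqVneq => [->|ts].
  rewrite rev_cons -cats1 -catA; apply: coxeter_eq_sym.
  by have := coxeter_eq_sq (rev l) s [::]; rewrite !cats0.
have [st|nst] := boolP (comm s t); last first.
  by rewrite !rev_cons -!cats1; apply: coxeter_eq_refl.
rewrite !rev_cons -!cats1.
apply: (coxeter_eq_trans (coxeter_eq_cat IH (coxeter_eq_refl [:: t]))).
by rewrite -!catA /=; have := coxeter_eq_swap (rev l) [::] st; rewrite !cats0.
Qed.

Lemma coxeter_eq_insert_word_nil u : coxeter_eq (rev (insert_word [::] u)) u.
Proof.
elim/last_ind: u => [|u s IH]; first exact: coxeter_eq_refl.
rewrite /insert_word foldl_rcons -cats1; apply: coxeter_eq_trans (coxeter_eq_insert _ _) _.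
exact: coxeter_eq_cat IH (coxeter_eq_refl _).
Qed.

(** Insertion represents multiplication, so a word reduced to the empty word is
    trivial.  Conversely the projections of the reduced word are invariant under
    the defining relations, and only the empty word has empty projections. *)
Theorem coxeter_eq_nil u : coxeter_eq u [::] <-> insert_word [::] u = [::].
Proof.
split=> [u1|u1]; last by have := coxeter_eq_insert_word_nil u; rewrite u1 => /coxeter_eq_sym.
exact/same_projections_nil/(coxeter_eq_insert_word u1).
Qed.

Lemma coxeter_eq_action (X : Type) (act : I -> X -> X) :
  (forall s, involutive (act s)) ->
  (forall s t (x : X), comm s t -> act s (act t x) = act t (act s x)) ->
  forall u v (x : X), coxeter_eq u v ->
  foldl (fun (x : X) s => act s x) x u = foldl (fun (x : X) s => act s x) x v.
Proof.
move=> actK actC u v x uv; elim: uv x => {u v}.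
- by [].
- by move=> u v _ IH x; rewrite IH.
- by move=> v u u' _ IH1 _ IH2 x; rewrite IH1.
- by move=> u s v x; rewrite !foldl_cat /= actK.
- by move=> u s t v st x; rewrite !foldl_cat /= actC // comm_sym.
Qed.

End RightAngledCoxeter.

(** * Embeddings of one-relator groups into right-angled Coxeter groups *)

Section Embedding.
Variables (A : finType) (w : word A) (I : finType) (comm : rel I).
Hypotheses (comm_sym : symmetric comm) (comm_irr : irreflexive comm).
Variable phi : A -> seq I.

Definition letter_image (x : letter A) := if x.2 then rev (phi x.1) else phi x.1.
Definition word_image (u : word A) := flatten (map letter_image u).

Lemma word_image_cat u v : word_image (u ++ v) = word_image u ++ word_image v.
Proof. by rewrite /word_image map_cat flatten_cat. Qed.

Lemma coxeter_eq_letterV x :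
  coxeter_eq comm (letter_image x ++ letter_image (inv_letter x)) [::].
Proof.
case: x => a [] /=; rewrite /letter_image /=; last exact: coxeter_eq_catV.
by have := coxeter_eq_catV comm (rev (phi a)); rewrite revK.
Qed.

Hypothesis phi_relator : coxeter_eq comm (word_image w) [::].

Lemma pres_coxeter_eq u v : pres_eq w u v -> coxeter_eq comm (word_image u) (word_image v).
Proof.
elim=> {u v} [u|u v _|v u u' _ IH1 _|u x v|u v].
- exact: coxeter_eq_refl.
- exact: coxeter_eq_sym.
- exact: coxeter_eq_trans IH1.
- rewrite !word_image_cat; apply: coxeter_eq_cat; first exact: coxeter_eq_refl.
  rewrite -[X in coxeter_eq _ _ X]cat0s.
  apply: coxeter_eq_cat; last exact: coxeter_eq_refl.
  by rewrite /word_image /= cats0; apply: coxeter_eq_letterV.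
- rewrite !word_image_cat; apply: coxeter_eq_cat; first exact: coxeter_eq_refl.
  rewrite -[X in coxeter_eq _ _ X]cat0s.
  by apply: coxeter_eq_cat; [exact: phi_relator|exact: coxeter_eq_refl].
Qed.

(** The word problem of the Coxeter group reflects to the one-relator group G as
    soon as the reflections act on G x C in a way that the image of a generator
    multiplies the copy of G at c0 by that generator.  Such an action is given
    by a permutation of C and a G-valued voltage on each edge c -> crossing s c;
    the hypotheses say that the defining relations have trivial voltage. *)
Variables (C : Type) (c0 : C).
Variables (crossing : I -> C -> C) (voltage : I -> C -> one_relator w).
Hypothesis crossingK : forall s, involutive (crossing s).
Hypothesis crossingC : forall s t c, comm s t ->
  crossing s (crossing t c) = crossing t (crossing s c).
Hypothesis voltageK : forall s c, (voltage s c * voltage s (crossing s c) = 1)%g.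
Hypothesis voltageC : forall s t c, comm s t ->
  (voltage s c * voltage t (crossing s c) = voltage t c * voltage s (crossing t c))%g.

Definition voltage_step (s : I) (p : one_relator w * C) :=
  ((p.1 * voltage s p.2)%g, crossing s p.2).
Definition voltage_walk (p : one_relator w * C) (u : seq I) :=
  foldl (fun p s => voltage_step s p) p u.

Hypothesis voltage_walk_phi : forall a x,
  voltage_walk (x, c0) (phi a) = ((x * elt w [:: (a, false)])%g, c0).

Lemma voltage_walk_coxeter_eq u v p :
  coxeter_eq comm u v -> voltage_walk p u = voltage_walk p v.
Proof.
move=> uv.
apply: (coxeter_eq_action comm_sym (act := voltage_step)) uv => [s [x c]|s t [x c] st].
  by rewrite /voltage_step /= -mulgA voltageK mulg1 crossingK.
by rewrite /voltage_step /= -!mulgA (voltageC _ st) crossingC.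
Qed.

Lemma voltage_walk_cat p u v : voltage_walk p (u ++ v) = voltage_walk (voltage_walk p u) v.
Proof. exact: foldl_cat. Qed.

Lemma voltage_walk_letter x y :
  voltage_walk (x, c0) (letter_image y) = ((x * elt w [:: y])%g, c0).
Proof.
case: y => a []; rewrite /letter_image /=; last exact: voltage_walk_phi.
have -> : (x, c0) = voltage_walk ((x * elt w [:: (a, true)])%g, c0) (phi a).
  by rewrite voltage_walk_phi -mulgA -elt_cat (_ : elt w _ = 1%g) ?mulg1 //;
    apply/eltP; exact: (pres_free w [::] (a, true) [::]).
by rewrite -voltage_walk_cat (voltage_walk_coxeter_eq _ (coxeter_eq_catV _ _)).
Qed.

Lemma voltage_walk_word x u : voltage_walk (x, c0) (word_image u) = ((x * elt w u)%g, c0).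
Proof.
elim: u x => [|y u IH] x; first by rewrite /= mulg1.
by rewrite /= voltage_walk_cat voltage_walk_letter IH -mulgA -elt_cat.
Qed.

(** A word with trivial image in the Coxeter group acts trivially, and it moves
    (1, c0) to (elt w u, c0). *)
Theorem coxeter_embedding u :
  pres_eq w u [::] <-> insert_word comm [::] (word_image u) = [::].
Proof.
rewrite -coxeter_eq_nil //; split=> [/pres_coxeter_eq //|u1].
by have := voltage_walk_coxeter_eq (1%g, c0) u1; rewrite voltage_walk_word mul1g => -[/eltP].
Qed.

End Embedding.

Definition coxeter_word_problem (A : finType) (w : word A) :=
  exists (I : finType) (comm : rel I) (phi : A -> seq I),
    forall u, pres_eq w u [::] <-> insert_word comm [::] (word_image phi u) = [::].

Lemma take_enum_ord g (j : 'I_g) :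
  take j.+1 (enum 'I_g) = rcons (take j (enum 'I_g)) j.
Proof. by rewrite (take_nth j) ?size_enum_ord // nth_ord_enum. Qed.

Ltac group_simpl :=
  rewrite ?(invgM, invgK, invg1, mulgA, mulgK, mulgVK, mulVg, mulgV, mul1g, mulg1).

(** * Non-orientable surface groups as reflection subgroups *)

Section Nonorientable.
Variable g : nat.
Let w := nonorientable_relator g.

(** The sides of a right-angled polygon: the side z is None, the others are
    p_0, ..., p_g.  Adjacent sides have commuting reflections. *)
Definition cycle_adjacent (s t : option 'I_g.+1) : bool :=
  match s, t with
  | None, None => false
  | None, Some i | Some i, None => (i == 0 :> nat) || (i == g :> nat)
  | Some i, Some j => (i.+1 == j) || (j.+1 == i)
  end.

Lemma cycle_adjacent_sym : symmetric cycle_adjacent.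
Proof. by case=> [i|] [j|] //=; rewrite orbC. Qed.

Lemma cycle_adjacent_irr : irreflexive cycle_adjacent.
Proof. by case=> [i|] //=; rewrite orbb gtn_eqF. Qed.

Definition mirror (n : nat) : option 'I_g.+1 := Some (inord n).
Definition crosscap_image (j : 'I_g) := [:: mirror j; None; mirror j.+1].

Lemma mirror_adjacent (j : 'I_g) : cycle_adjacent (mirror j) (mirror j.+1).
Proof. by rewrite /= !inordK ?eqxx // ltnS // ltnW. Qed.

(** The product of the squares telescopes to (p_0 z)^2 (p_g z)^-2, trivial as p_0
    and p_g commute with z. *)
Lemma crosscap_image_relator :
  coxeter_eq cycle_adjacent (word_image crosscap_image w) [::].
Proof.
have partial n : n <= g -> coxeter_eq cycle_adjacent
   (word_image crosscap_image
     (flatten [seq [:: (i, false); (i, false)] | i <- take n (enum 'I_g)]))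
   (square_ratio (mirror 0) None (mirror n)).
  elim: n => [_|n IH ng].
    by rewrite take0; apply/coxeter_eq_sym/square_ratio_id.
  rewrite -[n]/(val (Ordinal ng)) take_enum_ord map_rcons -cats1 flatten_cat word_image_cat.
  set j := Ordinal ng.
  apply: coxeter_eq_trans (coxeter_eq_cat (IH (ltnW ng)) (coxeter_eq_refl _ _)) _.
  rewrite /word_image /= /letter_image /= /crosscap_image /=.
  set p := mirror n; set q := mirror n.+1; set x := mirror 0.
  have pq : cycle_adjacent q p by rewrite cycle_adjacent_sym; exact: (mirror_adjacent j).
  pose h := [:: x; None; x; None; None].
  (* p z q p z q = (pzpz)(zqzq), as p and q commute. *)
  apply: coxeter_eq_trans (coxeter_eq_sq _ (h ++ [:: p; None]) p [:: None; q; p; None; q]) _.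
  apply: coxeter_eq_trans (coxeter_eq_sq _ (h ++ [:: p]) None [:: q; p; None; q]) _.
  apply: coxeter_eq_trans (coxeter_eq_swap (h ++ [:: p]) [:: None; q] pq) _.
  exact: (coxeter_eq_sq _ h p [:: q; None; q]).
have := partial g (leqnn g); rewrite take_oversize ?size_enum_ord // => /coxeter_eq_trans; apply.
apply: square_ratio_comm; first by rewrite /= inordK.
by rewrite /= inordK // eqxx orbT.
Qed.

Definition crosscap_product n := elt w [seq (i, false) | i <- take n (enum 'I_g)].
Definition square_product n :=
  elt w (flatten [seq [:: (i, false); (i, false)] | i <- take n (enum 'I_g)]).

Lemma crosscap_product0 : crosscap_product 0 = 1%g.
Proof. by rewrite /crosscap_product take0. Qed.

Lemma square_product0 : square_product 0 = 1%g.
Proof. by rewrite /square_product take0. Qed.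

Lemma square_product_full : square_product g = 1%g.
Proof. by rewrite /square_product take_oversize ?size_enum_ord // elt_relator. Qed.

Lemma crosscap_productS (j : 'I_g) :
  crosscap_product j.+1 = (crosscap_product j * elt w [:: (j, false)])%g.
Proof. by rewrite /crosscap_product take_enum_ord map_rcons -cats1 elt_cat. Qed.

Lemma square_productS (j : 'I_g) :
  square_product j.+1 = (square_product j * elt w [:: (j, false)] * elt w [:: (j, false)])%g.
Proof.
rewrite /square_product take_enum_ord map_rcons -cats1 flatten_cat elt_cat -mulgA.
by congr (_ * _)%g; rewrite -elt_cat.
Qed.

(** The four chambers around the surface: z, the p_j with even j and the p_j with
    odd j are coloured by the three non-zero elements of (Z/2)^2, so that the word
    p_j z p_(j+1) returns to its chamber. *)
Definition crosscap_crossing (s : option 'I_g.+1) (c : bool * bool) :=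
  match s with
  | None => (~~ c.1, ~~ c.2)
  | Some i => if odd i then (c.1, ~~ c.2) else (~~ c.1, c.2)
  end.

(** With voltage 1 on z, the requirement that p_j z p_(j+1) has voltage a_j at
    (0, 0) forces the voltage of p_i there to be the inverse of a_0 ... a_(i-1).
    Commutation of p_i and p_(i+1) then forces all other values; the surface
    relation is what makes p_g commute with z. *)
Definition crosscap_voltage (s : option 'I_g.+1) (c : bool * bool) : one_relator w :=
  match s with
  | None => 1%g
  | Some i =>
    match (if odd i then (c.2, c.1) else c) with
    | (false, false) => (crosscap_product i)^-1
    | (true, false) => crosscap_product i
    | (true, true) => square_product i * (crosscap_product i)^-1
    | (false, true) => crosscap_product i * (square_product i)^-1
    end%g
  end.

Theorem nonorientable_coxeter : coxeter_word_problem w.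
Proof.
exists (option 'I_g.+1 : finType), cycle_adjacent, crosscap_image.
have voltageCS (j : 'I_g) c (i k : 'I_g.+1) : i = j :> nat -> k = j.+1 :> nat ->
    let V := crosscap_voltage in let X := crosscap_crossing in
    (V (Some i) c * V (Some k) (X (Some i) c) =
     V (Some k) c * V (Some i) (X (Some k) c))%g.
  move=> ij kj; case: c => -[] []; rewrite /= ij kj /=; case: (odd j) => /=;
    by rewrite crosscap_productS square_productS; group_simpl.
have voltageCZ c (i : 'I_g.+1) : (i == 0 :> nat) || (i == g :> nat) ->
    let V := crosscap_voltage in let X := crosscap_crossing in
    (V None c * V (Some i) (X None c) = V (Some i) c * V None (X (Some i) c))%g.
  by case/orP => /eqP i0; case: c => -[] []; rewrite /= i0
    ?crosscap_product0 ?square_product0 ?square_product_full;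
    case: (odd _) => /=; group_simpl.
apply: (@coxeter_embedding _ _ _ _ cycle_adjacent_sym cycle_adjacent_irr _
  crosscap_image_relator _ (false, false) crosscap_crossing crosscap_voltage).
- by case=> [i|] [[] []] //=; case: (odd i).
- by case=> [i|] [j|] [[] []] //=; try case: (odd i); try case: (odd j).
- by case=> [i|] [[] []] /=; try case: (odd i) => /=; group_simpl.
- case=> [i|] [j|] c //; last 2 first.
  + by move/voltageCZ => ->.
  + exact: voltageCZ.
  case/orP => /eqP ij.
    have ig : i < g by rewrite -ltnS ij.
    exact: (voltageCS (Ordinal ig)).
  have jg : j < g by rewrite -ltnS ij.
  by symmetry; apply: (voltageCS (Ordinal jg)).
- move=> j x; rewrite /crosscap_image /voltage_walk /= /voltage_step /=.
  rewrite !inordK ?ltnS //; last exact: ltnW.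
  by rewrite /=; case: (odd j) => /=; rewrite crosscap_productS; group_simpl.
Qed.

End Nonorientable.

(** * Orientable surface groups as reflection subgroups *)

Section Orientable.
Variable g : nat.
Let w := orientable_relator g.

(** The sides of a right-angled polygon in cyclic order: z (None), p_0, q_0, p_1,
    q_1, ..., q_(g-1), p_g, where p_i is inl i and q_j is inr j. *)
Definition handle_adjacent (s t : option ('I_g.+1 + 'I_g)) : bool :=
  match s, t with
  | None, Some (inl i) | Some (inl i), None => (i == 0 :> nat) || (i == g :> nat)
  | Some (inl i), Some (inr j) | Some (inr j), Some (inl i) =>
    (i == j :> nat) || (i == j.+1 :> nat)
  | _, _ => false
  end.

Lemma handle_adjacent_sym : symmetric handle_adjacent.
Proof. by case=> [[i|i]|] [[j|j]|]. Qed.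

Lemma handle_adjacent_irr : irreflexive handle_adjacent.
Proof. by case=> [[i|i]|]. Qed.

Definition outer_mirror (n : nat) : option ('I_g.+1 + 'I_g) := Some (inl (inord n)).
Definition inner_mirror (j : 'I_g) : option ('I_g.+1 + 'I_g) := Some (inr j).
Definition handle_image (x : 'I_g + 'I_g) :=
  match x with
  | inl j => [:: outer_mirror j; None; inner_mirror j; outer_mirror j]
  | inr j => [:: outer_mirror j.+1; outer_mirror j]
  end.

Definition commutator_word (j : 'I_g) : word ('I_g + 'I_g)%type :=
  [:: (inl j, false); (inr j, false); (inl j, true); (inr j, true)].

(** The image of [a_j,b_j] is (p_j z)^2 (p_(j+1) z)^-2, and the product telescopes
    to (p_0 z)^2 (p_g z)^-2, trivial as p_0 and p_g commute with z. *)
Lemma handle_image_relator :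
  coxeter_eq handle_adjacent (word_image handle_image w) [::].
Proof.
have partial n : n <= g -> coxeter_eq handle_adjacent
   (word_image handle_image (flatten [seq commutator_word i | i <- take n (enum 'I_g)]))
   (square_ratio (outer_mirror 0) None (outer_mirror n)).
  elim: n => [_|n IH ng].
    by rewrite take0; apply/coxeter_eq_sym/square_ratio_id.
  rewrite -[n]/(val (Ordinal ng)) take_enum_ord map_rcons -cats1 flatten_cat word_image_cat.
  set j := Ordinal ng.
  apply: coxeter_eq_trans (coxeter_eq_cat (IH (ltnW ng)) (coxeter_eq_refl _ _)) _.
  rewrite /word_image /= /letter_image /= /rev /=.
  set p := outer_mirror n; set r := outer_mirror n.+1; set x := outer_mirror 0.
  set q := inner_mirror j.
  have pq : handle_adjacent p q by rewrite /= inordK ?eqxx // ltnS ltnW.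
  have qr : handle_adjacent q r by rewrite /= inordK ?eqxx ?orbT.
  pose h := [:: x; None; x; None; None].
  (* [a_j, b_j] = (pzqp)(rp)(pqzp)(pr) = (pzpz)(zrzr), as q commutes with p and r. *)
  apply: coxeter_eq_trans (coxeter_eq_sq _ (h ++ [:: p; None]) p
    [:: None; q; p; r; p; p; q; None; p; p; r]) _.
  apply: coxeter_eq_trans (coxeter_eq_sq _ (h ++ [:: p]) None
    [:: q; p; r; p; p; q; None; p; p; r]) _.
  apply: coxeter_eq_trans (coxeter_eq_swap h [:: p; r; p; p; q; None; p; p; r] pq) _.
  apply: coxeter_eq_trans (coxeter_eq_sq _ (h ++ [:: q]) p [:: r; p; p; q; None; p; p; r]) _.
  apply: coxeter_eq_trans (coxeter_eq_sq _ (h ++ [:: q; r]) p [:: q; None; p; p; r]) _.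
  apply: coxeter_eq_trans (coxeter_eq_sq _ (h ++ [:: q; r; q; None]) p [:: r]) _.
  apply: coxeter_eq_trans (coxeter_eq_swap h [:: q; None; r] qr) _.
  exact: (coxeter_eq_sq _ (h ++ [:: r]) q [:: None; r]).
have := partial g (leqnn g); rewrite take_oversize ?size_enum_ord // => /coxeter_eq_trans; apply.
apply: square_ratio_comm; first by rewrite /= inordK.
by rewrite /= inordK // eqxx orbT.
Qed.

Definition gen_a j := elt w [:: (inl j, false)].
Definition gen_b j := elt w [:: (inr j, false)].
Definition b_product n := elt w [seq (inr i, false) | i <- rev (take n (enum 'I_g))].
Definition commutator_product n :=
  elt w (flatten [seq commutator_word i | i <- take n (enum 'I_g)]).

Lemma b_product0 : b_product 0 = 1%g.
Proof. by rewrite /b_product take0. Qed.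

Lemma commutator_product0 : commutator_product 0 = 1%g.
Proof. by rewrite /commutator_product take0. Qed.

Lemma commutator_product_full : commutator_product g = 1%g.
Proof. by rewrite /commutator_product take_oversize ?size_enum_ord // elt_relator. Qed.

Lemma b_productS (j : 'I_g) : b_product j.+1 = (gen_b j * b_product j)%g.
Proof. by rewrite /b_product take_enum_ord rev_rcons /gen_b -elt_cat. Qed.

Lemma commutator_productS (j : 'I_g) : commutator_product j.+1 =
  (commutator_product j * gen_a j * gen_b j * (gen_a j)^-1 * (gen_b j)^-1)%g.
Proof.
rewrite /commutator_product take_enum_ord map_rcons -cats1 flatten_cat elt_cat -!mulgA.
congr (_ * _)%g; rewrite /gen_a /gen_b -!elt_inv.
by rewrite -[flatten _]/([:: (inl j, false)] ++ [:: (inr j, false)] ++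
  [:: (inl j, true)] ++ [:: (inr j, true)]) !elt_cat.
Qed.

(** Two colours suffice here, since the sides of the polygon alternate: z and the
    q_j have one colour, the p_i the other. *)
Definition handle_crossing (s : option ('I_g.+1 + 'I_g)) (c : bool * bool) :=
  if s is Some (inl _) then (c.1, ~~ c.2) else (~~ c.1, c.2).

(** As in the non-orientable case, the values are forced by voltage 1 on z, by the
    voltages a_j and b_j of the images of the generators at (0, 0), and by
    commutation of adjacent mirrors. *)
Definition handle_voltage (s : option ('I_g.+1 + 'I_g)) (c : bool * bool) : one_relator w :=
  match s, c with
  | None, _ => 1%g
  | Some (inl i), (false, false) => b_product i
  | Some (inl i), (false, true) => (b_product i)^-1
  | Some (inl i), (true, false) => commutator_product i * b_product i
  | Some (inl i), (true, true) => (b_product i)^-1 * (commutator_product i)^-1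
  | Some (inr j), (false, false) => (gen_a j)^-1 * (commutator_product j)^-1
  | Some (inr j), (true, false) => commutator_product j * gen_a j
  | Some (inr j), (true, true) => (b_product j)^-1 * gen_a j * b_product j
  | Some (inr j), (false, true) => (b_product j)^-1 * (gen_a j)^-1 * b_product j
  end%g.

Theorem orientable_coxeter : coxeter_word_problem w.
Proof.
exists (option ('I_g.+1 + 'I_g)%type : finType), handle_adjacent, handle_image.
have voltageCQ (j : 'I_g) (i : 'I_g.+1) c : (i == j :> nat) || (i == j.+1 :> nat) ->
    let V := handle_voltage in let X := handle_crossing in
    (V (Some (inl i)) c * V (inner_mirror j) (X (Some (inl i)) c) =
     V (inner_mirror j) c * V (Some (inl i)) (X (inner_mirror j) c))%g.
  by case/orP => /eqP ij; case: c => -[] [];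
    rewrite /= ij ?b_productS ?commutator_productS; group_simpl.
have voltageCZ c (i : 'I_g.+1) : (i == 0 :> nat) || (i == g :> nat) ->
    let V := handle_voltage in let X := handle_crossing in
    (V None c * V (Some (inl i)) (X None c) =
     V (Some (inl i)) c * V None (X (Some (inl i)) c))%g.
  by case/orP => /eqP i0; case: c => -[] []; rewrite /= i0
    ?b_product0 ?commutator_product0 ?commutator_product_full; group_simpl.
apply: (@coxeter_embedding _ _ _ _ handle_adjacent_sym handle_adjacent_irr _
  handle_image_relator _ (false, false) handle_crossing handle_voltage).
- by case=> [[i|i]|] [[] []].
- by case=> [[i|i]|] [[j|j]|] [[] []].
- by case=> [[i|i]|] [[] []] /=; group_simpl.
- case=> [[i|i]|] [[j|j]|] c //.
  + exact: voltageCQ.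
  + by move/voltageCZ => ->.
  + by move/voltageCQ => ->.
  + exact: voltageCZ.
- case=> j x; rewrite /voltage_walk /= /voltage_step /= !inordK ?ltnS //; try exact: ltnW.
    by group_simpl.
  by rewrite b_productS; group_simpl.
Qed.

End Orientable.

(** * Products of prefixes and the decision procedure *)

Section PrefixProducts.
Variables (A : finType) (w : word A).

Definition proper_prefixes : seq (word A) := [seq take i w | i <- iota 1 (size w).-1].

Lemma proper_prefixP p : p \in proper_prefixes -> prefix p w.
Proof. by case/mapP => i _ ->; apply: prefix_take. Qed.

Lemma prefix_cases p : prefix p w ->
  [\/ p = [::], p = w | p \in proper_prefixes].
Proof.
rewrite prefixE => /eqP pE.
have [p0|p0] := posnP (size p); first by constructor 1; apply: size0nil.
have [le|lt] := leqP (size w) (size p).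
  by constructor 2; rewrite -pE take_oversize.
constructor 3; apply/mapP; exists (size p); last by rewrite pE.
by rewrite mem_iota p0 add1n prednK // (leq_ltn_trans _ lt).
Qed.

Lemma prefix_monoidP x : prefix_monoid w x <->
  exists2 ps, {subset ps <= proper_prefixes} & elt w (flatten ps) = x.
Proof.
split=> [[s [Ss <-]]|[ps sub <-]].
  elim: s Ss => [_|y s IH Ss]; first by exists [::]; rewrite ?big_nil.
  have [ps sub E] := IH (fun z zs => Ss z (@mem_behead _ (y :: s) _ zs)).
  have [p /prefix_cases pw <-] := Ss y (mem_head _ _).
  case: pw => [->|->|pw]; rewrite big_cons.
  - by exists ps; rewrite // E mul1g.
  - by exists ps; rewrite // E elt_relator mul1g.
  - exists (p :: ps); last by rewrite /= elt_cat E.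
    by move=> q; rewrite inE => /orP[/eqP->|/sub].
exists (map (elt w) ps); split.
  by move=> y /mapP[p /sub/proper_prefixP pw ->]; exists p.
elim: ps {sub} => [|p ps IH]; first by rewrite big_nil.
by rewrite /= big_cons elt_cat IH.
Qed.

(** For a fixed u the bound must hold for all words representing the same element,
    so this is a statement about word length in the group.  In particular no
    non-empty product of proper non-empty prefixes is trivial. *)
Definition linear_prefix_products := exists c, forall (ps : seq (word A)) (u : word A),
  {subset ps <= proper_prefixes} -> elt w (flatten ps) = elt w u ->
  size ps <= c * size u.

End PrefixProducts.

Section Decidability.
Variables (A : finType) (w : word A).

(** If P is the whole group, the constant function 1 decides membership. *)
Lemma decidable_all : (forall x : letter A, prefix_monoid w (elt w [:: x])) ->
  decidable_prefix_membership w.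
Proof.
move=> Px; apply: (computable_decidable (f := fun=> true)); last first.
  exact: computable_const.
move=> u; split=> // _; apply/prefix_monoidP.
elim: u => [|x u [ps sub E]]; first by exists [::].
have /prefix_monoidP[qs sub' E'] := Px x.
exists (qs ++ ps); last by rewrite flatten_cat elt_cat E E' -elt_cat.
by move=> p; rewrite mem_cat => /orP[/sub'|/sub].
Qed.

Variables (I : finType) (comm : rel I) (phi : A -> seq I).
Hypothesis word_problem :
  forall u, pres_eq w u [::] <-> insert_word comm [::] (word_image phi u) = [::].
Variable c : nat.
Hypothesis bound : forall (ps : seq (word A)) (u : word A),
  {subset ps <= proper_prefixes w} -> elt w (flatten ps) = elt w u ->
  size ps <= c * size u.

(** One round of the search: every candidate v is replaced by all q v.  Candidates
    are kept as lists of reflections, which the word problem is solved for. *)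
Definition expand (Q : seq (seq I)) (L : seq (seq I)) : seq (seq I) :=
  foldr (fun v acc => [seq q ++ v | q <- Q] ++ acc) [::] L.

(** The empty prefix pads shorter products to the common length c * size u. *)
Definition steps : seq (word A) := [::] :: proper_prefixes w.
Definition inverse_steps := [seq word_image phi (inv_word p) | p <- steps].
Definition trivial_image (v : seq I) := nilp (insert_word comm [::] v).
Definition in_prefix_monoid (u : word A) : bool :=
  has trivial_image (iter (c * size u) (expand inverse_steps) [:: word_image phi u]).

Lemma mem_expand Q L v :
  reflect (exists q v', [/\ q \in Q, v' \in L & v = q ++ v']) (v \in expand Q L).
Proof.
apply: (iffP idP) => [|[q [v' [qQ]]]].
  elim: L => //= v' L IH; rewrite mem_cat => /orP[/mapP[q qQ ->]|/IH].
    by exists q, v'; rewrite mem_head.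
  by move=> [q [v'' [qQ vL ->]]]; exists q, v''; rewrite in_cons vL orbT.
elim: L => //= v'' L IH; rewrite in_cons mem_cat => /orP[/eqP-> ->|vL vE].
  by rewrite (map_f (fun q => q ++ v'')).
by rewrite IH // orbT.
Qed.

Lemma mem_iter_expand n u v :
  (v \in iter n (expand inverse_steps) [:: word_image phi u]) <->
  exists ps, [/\ size ps = n, {subset ps <= steps} &
    v = word_image phi (inv_word (flatten ps) ++ u)].
Proof.
elim: n v => [|n IH] v /=.
  rewrite inE; split=> [/eqP->|[ps [/size0nil-> _ ->]]] //.
  by exists [::].
split=> [/mem_expand[q [v' [/mapP[p pw ->] /IH[ps [sz sub ->]] ->]]]|].
  exists (rcons ps p); split; first by rewrite size_rcons sz.
    by move=> r; rewrite mem_rcons inE => /orP[/eqP->|/sub].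
  by rewrite flatten_rcons inv_word_cat -catA !word_image_cat.
case=> ps; case/lastP: ps => [[]//|ps p]; rewrite size_rcons => -[[sz] sub ->].
apply/mem_expand; exists (word_image phi (inv_word p)).
exists (word_image phi (inv_word (flatten ps) ++ u)); split.
- by apply/mapP; exists p => //; apply: sub; rewrite mem_rcons mem_head.
- apply/IH; exists ps; split=> // r rps; apply: sub.
  by rewrite mem_rcons inE rps orbT.
- by rewrite flatten_rcons inv_word_cat -catA !word_image_cat.
Qed.

Lemma in_prefix_monoidP u : in_prefix_monoid u <-> prefix_monoid w (elt w u).
Proof.
have trivE ps : trivial_image (word_image phi (inv_word (flatten ps) ++ u)) <->
    elt w (flatten ps) = elt w u.
  rewrite /trivial_image; split.
    move=> /nilP/word_problem/eltP; rewrite elt_cat elt_inv elt_nil => /mulg1_eq.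
    by rewrite invgK.
  move=> E; apply/nilP/word_problem/eltP.
  by rewrite elt_cat elt_inv E mulVg elt_nil.
split=> [/hasP[v /mem_iter_expand[ps [_ sub ->]] /trivE <-]|].
  apply/prefix_monoidP; exists (filter (fun p => ~~ nilp p) ps).
    move=> p; rewrite mem_filter => /andP[p0 /sub].
    by rewrite inE; case: p p0.
  congr elt; elim: ps {sub} => //= p ps IH.
  by case: ifPn => [_|]; rewrite /= IH // negbK => /nilP->.
case/prefix_monoidP=> ps sub E; have sz := bound sub E.
apply/hasP; pose qs := ps ++ nseq (c * size u - size ps) [::].
exists (word_image phi (inv_word (flatten qs) ++ u)).
  apply/mem_iter_expand; exists qs; split=> //.
    by rewrite size_cat size_nseq subnKC.
  move=> p; rewrite mem_cat => /orP[/sub pw|].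
    by rewrite inE pw orbT.
  by rewrite mem_nseq => /andP[_ /eqP->]; rewrite mem_head.
apply/trivE; rewrite -E; congr elt; rewrite flatten_cat.
by elim: (_ - _) => //= ; rewrite cats0.
Qed.

(** Insertion recurses on a tail that it also returns, which a fold can express
    only by rebuilding the tail alongside the result. *)
Lemma insert_foldr s l :
  (l, insert comm s l) = foldr (fun t st => (t :: st.1,
     if t == s then st.1 else if comm s t then t :: st.2 else [:: s, t & st.1]))
  ([::], [:: s]) l.
Proof. by elim: l => //= t l <-. Qed.

Lemma computable_insert : computable (fun p : seq I * I => insert comm p.2 p.1).
Proof.
have cs s : computable (fun p : seq I * I => insert comm s p.1).
  pose h t (q : (I * (seq I * seq I)) * (seq I * I)) := (t :: q.1.2.1,
     if t == s then q.1.2.1 else if comm s t then t :: q.1.2.2 else [:: s, t & q.1.2.1]).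
  apply: (computable_ext (f := fun p =>
    (foldr (fun t st => h t ((t, st), p)) ([::], [:: s]) p.1).2)).
    by move=> p; rewrite /h /= -insert_foldr.
  apply: computable_snd; apply: (computable_foldr (h := fun q => h q.1.1 q)).
  - by solve_projection.
  - apply: computable_fin; last by solve_projection.
    move=> t; apply: computable_pair.
      by apply: computable_cons; [exact: computable_const|solve_projection].
    case: (t == s); first by solve_projection.
    case: (comm s t).
      by apply: computable_cons; [exact: computable_const|solve_projection].
    by do 2 (apply: computable_cons; first exact: computable_const); solve_projection.
  - exact: computable_const.
by apply: (computable_fin cs); solve_projection.
Qed.

Lemma computable_flatten_map (T : finType) (f : T -> seq I) :
  computable (fun u => flatten (map f u)).
Proof.
apply: (computable_ext (f := fun u => foldr (fun x acc => f x ++ acc) [::] u)).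
  by elim=> //= x u ->.
apply: (computable_foldr (h := fun q : (T * seq I) * seq T => f q.1.1 ++ q.1.2)).
- exact: computable_id.
- apply: (computable_fin (f := fun x (q : (T * seq I) * seq T) => f x ++ q.1.2)).
    by move=> x; apply: computable_cat_const; solve_projection.
  by solve_projection.
- exact: computable_const.
Qed.

Lemma computable_trivial_image : computable trivial_image.
Proof.
apply: computable_nilp.
apply: (computable_foldl (h := fun q : (seq I * I) * seq I => insert comm q.1.2 q.1.1)).
- exact: computable_id.
- by apply: (computable_comp computable_insert); solve_projection.
- exact: computable_const.
Qed.

Lemma computable_expand Q : computable (expand Q).
Proof.
apply: (computable_foldr (h := fun q : (seq I * seq (seq I)) * seq (seq I) =>
  [seq q' ++ q.1.1 | q' <- Q] ++ q.1.2)).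
- exact: computable_id.
- elim: Q => [|q Q IH] /=; first by solve_projection.
  by apply: computable_cons IH; apply: computable_cat_const; solve_projection.
- exact: computable_const.
Qed.

Lemma computable_search (T : finType) (f : T -> seq I) (n : nat) Q :
  computable (fun u : seq T =>
    has trivial_image (iter (n * size u) (expand Q) [:: flatten (map f u)])).
Proof.
apply: (computable_comp (g := fun L => has trivial_image L)
   (f := fun u : seq T => iter (n * size u) (expand Q) [:: flatten (map f u)])).
  apply: (computable_ext (f := fun L =>
    foldr (fun v b => if trivial_image v then true else b) false L)).
    by elim=> //= v L ->; case: trivial_image.
  apply: (computable_foldr (h := fun q : (seq I * bool) * seq (seq I) =>
    if trivial_image q.1.1 then true else q.1.2)).
  - exact: computable_id.
  - apply: computable_if; [|exact: computable_const|by solve_projection].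
    by apply: (computable_comp computable_trivial_image); solve_projection.
  - exact: computable_const.
apply: (computable_iter (s := fun q : seq (seq I) * seq T => expand Q q.1)).
- apply: (computable_ext (f := fun u : seq T => foldr (fun _ m => n + m) 0 u)).
    by elim=> [|x u IH] /=; rewrite ?muln0 // IH mulnS.
  apply: (computable_foldr (h := fun q : (T * nat) * seq T => n + q.1.2)).
  + exact: computable_id.
  + elim: n => [|m IH].
      by apply: (computable_ext (f := fun q : (T * nat) * seq T => q.1.2)) => //; solve_projection.
    apply: (computable_comp (g := succn) (f := fun q : (T * nat) * seq T => m + q.1.2)) IH.
    by exists succn => //; apply: recursive1_succ.
  + exact: computable_const.
- by apply: (computable_comp (computable_expand _)); solve_projection.
- by apply: computable_cons; [exact: computable_flatten_map|exact: computable_const].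
Qed.

Theorem decidable_prefixes : decidable_prefix_membership w.
Proof.
exact: computable_decidable in_prefix_monoidP (computable_search _ _ _).
Qed.

End Decidability.

(** * Linear distortion *)

Section Distortion.
Local Open Scope classical_set_scope.

Lemma finite_bounded_seqs (T : eqType) (S : set T) (n : nat) : finite_set S ->
  finite_set [set s : seq T | {in s, forall x, S x} /\ size s <= n].
Proof.
move=> finS; elim: n => [|n IH].
  apply: sub_finite_set (finite_set1 [::]) => s [_]; rewrite leqn0.
  by move/eqP/size0nil.
have : finite_set ([set [::]] `|` [set x :: s | x in S & s in
    [set s : seq T | {in s, forall x, S x} /\ size s <= n]]).
  by rewrite finite_setU; split; [exact: finite_set1|exact: finite_image2].
apply: sub_finite_set => -[|x s] [Ss sz] /=; first by left.
right; exists x; first by apply: Ss; rewrite mem_head.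
exists s => //; split=> // y ys; apply: Ss.
by rewrite inE ys orbT.
Qed.

Lemma finite_set_bound (T : choiceType) (X : set T) (f : T -> nat) :
  finite_set X -> exists m, forall x, X x -> f x <= m.
Proof.
move=> /finite_seqP[s ->]; exists (\max_(x <- s) f x) => x xs.
exact: leq_bigmax_seq.
Qed.

(** A factor 1 could be repeated at will. *)
Lemma factors_nontrivial (G : monoidType) (P S : set G) x :
  graded_wrt P S -> S x -> x <> 1%g.
Proof.
move=> [[finS genS] finF] Sx x1.
have P1 : P 1%g by rewrite -genS; exists [::]; split; rewrite ?big_nil.
apply: infinite_nat.
apply: (@sub_finite_set _ _ ((fun k => nseq k x) @^-1` factorizations S 1%g)).
  move=> k _; split; first by move=> y; rewrite mem_nseq => /andP[_ /eqP->].
  by rewrite big_nseq x1; elim: k => //= k ->; rewrite mul1g.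
apply: finite_preimage; last exact: finF.
by move=> i j _ _ /(congr1 size); rewrite !size_nseq.
Qed.

Variables (A : finType) (w : word A) (c : nat).
Hypothesis bound : forall (ps : seq (word A)) (u : word A),
  {subset ps <= proper_prefixes w} -> elt w (flatten ps) = elt w u ->
  size ps <= c * size u.

(** Each non-trivial element of the monoid takes at least one proper prefix. *)
Lemma factorization_bound (s : seq (one_relator w)) u :
  {in s, forall x, prefix_monoid w x /\ x <> 1%g} ->
  (\prod_(x <- s) x)%g = elt w u -> size s <= c * size u.
Proof.
move=> Ss E.
have [ps sub [E' sz]] : exists2 ps, {subset ps <= proper_prefixes w} &
    elt w (flatten ps) = (\prod_(x <- s) x)%g /\ size s <= size ps.
  elim: s Ss {E} => [|x s IH] Ss; first by exists [::]; rewrite // big_nil.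
  have [|ps sub [E sz]] := IH; first by move=> y ys; apply: Ss; rewrite inE ys orbT.
  have [/prefix_monoidP[qs sub' E'] x1] := Ss x (mem_head _ _).
  exists (qs ++ ps); first by move=> p; rewrite mem_cat => /orP[/sub'|/sub].
  rewrite big_cons flatten_cat elt_cat E E' size_cat; split=> //=.
  by case: qs E' {sub'} => [E'|q qs _]; [case: x1|rewrite /= ltnS (leq_trans sz) ?leq_addl].
by rewrite (leq_trans sz) // bound // E'.
Qed.

Lemma prefix_monoid_graded : graded (prefix_monoid w).
Proof.
pose S := [set elt w p | p in [set` proper_prefixes w]].
have SP x : S x -> prefix_monoid w x /\ x <> 1%g.
  move=> [p /= pw <-]; split.
    apply/prefix_monoidP; exists [:: p]; last by rewrite /= cats0.
    by move=> q; rewrite inE => /eqP->.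
  have sub : {subset [:: p] <= proper_prefixes w} by move=> q; rewrite inE => /eqP->.
  by move=> p1; have := @bound _ [::] sub; rewrite /= cats0 muln0 => /(_ p1).
exists S; split; first split.
- by apply: finite_image; apply: finite_seq.
- apply/seteqP; split=> x.
    move=> [s [Ss <-]]; apply/prefix_monoidP.
    elim: s Ss => [_|y s IH Ss]; first by exists [::]; rewrite ?big_nil.
    have [|ps sub E] := IH; first by move=> z zs; apply: Ss; rewrite inE zs orbT.
    have [p pw <-] := Ss y (mem_head _ _).
    exists (p :: ps); last by rewrite big_cons /= elt_cat E.
    by move=> q; rewrite inE => /orP[/eqP->|/sub].
  case/prefix_monoidP => ps sub <-; exists (map (elt w) ps); split.
    by move=> y /mapP[p /sub pw ->]; exists p.
  elim: ps {sub} => [|p ps IH]; first by rewrite big_nil.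
  by rewrite /= big_cons elt_cat IH.
- move=> x _; apply: sub_finite_set (@finite_bounded_seqs _ S (c * size (repr x)) _).
    move=> s [Ss E]; split=> //; apply: factorization_bound.
      by move=> y /Ss /SP.
    by rewrite E elt_surj.
  by apply: finite_image; apply: finite_seq.
Qed.

(** If m bounds the length of words for the elements of X, an element of X-length n
    has a word of length at most m n, hence at most c m n factors in S. *)
Theorem prefix_monoid_linear_distortion : has_linear_upper_distortion (prefix_monoid w).
Proof.
split; first exact: prefix_monoid_graded.
move=> S X gS [finX genX].
have [m le_m] := finite_set_bound (fun x : one_relator w => size (repr x)) finX.
exists (fun n => c * (m * n)); last first.
  exists (c * m).+1, 1; split=> // n.
  by rewrite mulnA addn1 ltnW // ltnS leq_mul.
split=> [i j ij|x Px]; first by rewrite !leq_mul2l ij !orbT.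
have [s [Xs sx] sz] : (factorization_lengths X x) (word_length X x).
  have [s Xs] : submonoid_gen X x by rewrite genX.
  pose Q n := `[< factorization_lengths X x n >].
  have exQ : exists n, Q n by exists (size s); apply/asboolP; exists s.
  have [n /asboolP Ln min_n] := ex_minnP exQ.
  rewrite /word_length.
  pose L : set nat := factorization_lengths X x.
  have Lmin : (L `&` lbound L) n by split=> // k Lk; apply: min_n; apply/asboolP.
  by have [] := xgetI 0 Lmin.
pose u := flatten (map repr s).
have uE : elt w u = x.
  rewrite -sx /u; elim: (s) => [|y l IH]; first by rewrite big_nil.
  by rewrite /= big_cons elt_cat IH elt_surj.
have sz_u : size u <= m * word_length X x.
  rewrite -sz /u; elim: (s) Xs => [|y l IH] Xs //=.
  rewrite size_cat mulnS leq_add //; first by apply/le_m/Xs/mem_head.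
  by apply: IH => z zl; apply: Xs; rewrite inE zl orbT.
rewrite (@leq_trans (c * size u)) ?leq_mul2l ?sz_u ?orbT //.
rewrite /upper_word_length; case: xgetP => // n _ [[t [St tx] <-] _].
apply: factorization_bound; last by rewrite tx uE.
move=> y /St Sy; split; last exact: factors_nontrivial gS Sy.
have [[_ <-] _] := gS; exists [:: y]; split; last by rewrite big_seq1.
by move=> z; rewrite inE => /eqP->.
Qed.

End Distortion.

(** * Bounds from weights *)

Section Weight.
Import Order.TTheory GRing.Theory Num.Theory.
Local Open Scope ring_scope.
Variables (A : finType) (w : word A) (val : A -> int).

Definition weight (u : word A) : int :=
  \sum_(x <- u) (if x.2 then - val x.1 else val x.1).

Lemma weight_cat u v : weight (u ++ v) = weight u + weight v.
Proof. exact: big_cat. Qed.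

Lemma weight_pres u v : weight w = 0 -> pres_eq w u v -> weight u = weight v.
Proof.
move=> w0; elim=> {u v} // [v u u' _ -> _ //|u x v|u v]; rewrite !weight_cat.
  rewrite {2}/weight !big_cons big_nil /= addr0; congr (_ + _).
  by case: (x.2); rewrite /= ?subrr ?addNr add0r.
by rewrite w0 add0r.
Qed.

(** The weight of a product of k proper prefixes is at least k, while a word of
    length n has weight at most c n. *)
Lemma weight_linear (c : nat) : weight w = 0 -> (forall a, `|val a| <= c%:Z) ->
  {in proper_prefixes w, forall p, 0 < weight p} -> linear_prefix_products w.
Proof.
move=> w0 le_c pos; exists c => ps u sub /eltP/(weight_pres w0) E.
have : (size ps)%:Z <= weight (flatten ps).
  elim: ps sub {E} => [|p ps IH] sub; first by rewrite /weight big_nil.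
  have := pos p (sub p (mem_head _ _)); rewrite /= weight_cat.
  have := IH (fun q qs => sub q (@mem_behead _ (p :: ps) q qs)).
  move: (weight p) (weight (flatten ps)) (size ps) => x y z; lia.
have : weight u <= c%:Z * (size u)%:Z.
  elim: u {E} => [|x u IH]; first by rewrite /weight big_nil mulr0.
  rewrite /weight big_cons -/(weight u).
  rewrite -[size _]add1n PoszD mulrDr mulr1; apply: lerD IH.
  apply: le_trans (le_c x.1); case: (x.2); last exact: ler_norm.
  by rewrite -normrN ler_norm.
by rewrite -E -PoszM -lez_nat => /[swap] /le_trans /[apply].
Qed.

End Weight.

Lemma torus_linear : linear_prefix_products (orientable_relator 1).
Proof.
have wE : orientable_relator 1 = [:: (inl ord0, false); (inr ord0, false);
  (inl ord0, true); (inr ord0, true)].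
  by rewrite /orientable_relator enum_ordSl enum_ord0.
apply: (@weight_linear _ _ (fun=> 1%R) 1) => [|a //|].
  by rewrite wE /weight !big_cons big_nil.
rewrite wE /proper_prefixes /= => p; rewrite !inE.
by move=> /or3P[] /eqP->; rewrite /weight !big_cons big_nil.
Qed.

Lemma nonorientable_linear n :
  linear_prefix_products (nonorientable_relator n.+2).
Proof.
pose val (i : 'I_n.+2) : int := (if i == ord0 then n.+1%:Z else - 1)%R.
(* The relator after the letters a_1 a_1; all its letters have weight -1. *)
pose r := flatten [seq [:: (i, false); (i, false)] | i <- map (lift ord0) (enum 'I_n.+1)].
have wE : nonorientable_relator n.+2 = [:: (ord0, false); (ord0, false)] ++ r.
  by rewrite /nonorientable_relator enum_ordSl.
have szr : size r = (n.+1).*2.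
  have sz2 (s : seq 'I_n.+2) :
      size (flatten [seq [:: (i, false); (i, false)] | i <- s]) = (size s).*2.
    by elim: s => //= i s ->.
  by rewrite sz2 size_map size_enum_ord.
have wr k : (weight val (take k r) = - (size (take k r))%:Z)%R.
  have : {subset take k r <= r} by move=> x; apply: mem_take.
  elim: (take k r) => [|x s IH] sub; first by rewrite /weight big_nil.
  rewrite /weight big_cons -/(weight _ _) IH; last first.
    by move=> y ys; apply: sub; rewrite inE ys orbT.
  have /flattenP[_ /mapP[_ /mapP[i _ ->] ->]] := sub x (mem_head _ _).
  by rewrite !inE orbb => /eqP-> /=; rewrite /val /=; lia.
have w0 : weight val [:: (ord0, false); (ord0, false)] = n.+1.*2.
  by rewrite /weight !big_cons big_nil /= /val eqxx; lia.
apply: (@weight_linear _ _ val n.+1).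
- by rewrite wE weight_cat w0 -[r]take_size wr take_size szr; lia.
- by move=> i; rewrite /val; case: eqP => _; lia.
(* The prefix of length i has weight n.+1 if i = 1, and 2 (n + 2) - i otherwise. *)
move=> p /mapP[i]; rewrite mem_iota wE size_cat szr /= => ibd ->.
rewrite -[_ :: _]/([:: _; _] ++ _) take_cat -[size [:: _; _]]/2; case: ltnP => i2.
  have -> : i = 1 by lia.
  by rewrite /weight big_cons big_nil /= /val eqxx.
by rewrite weight_cat w0 wr size_take szr; case: ifP; lia.
Qed.

(** * Bounds from the free group of rank two *)

Section FreeGroup.
Variables (A : finType) (w : word A) (psi : A -> option bool).

(** Right multiplication by a letter in the free group; words are listed from the
    last letter to the first. *)
Definition push (l : word bool) (x : letter bool) : word bool :=
  if l is y :: l' then if y == inv_letter x then l' else x :: l else [:: x].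

Definition pushes := foldl push.

Fixpoint free_reduced (l : word bool) : bool :=
  if l is x :: l' then (ohead l' != Some (inv_letter x)) && free_reduced l' else true.

Lemma pushK l x : free_reduced l -> push (push l x) (inv_letter x) = l.
Proof.
case: l => [|y l] /=; first by rewrite inv_letterK eqxx.
case: (eqVneq y (inv_letter x)) => [-> |_ _]; last by rewrite /= inv_letterK eqxx.
case: l => //= z l; rewrite inv_letterK; case: (eqVneq z x) => [->|_] //.
by rewrite eqxx.
Qed.

Lemma free_reduced_push l x : free_reduced l -> free_reduced (push l x).
Proof.
case: l => [|y l] //= /andP[yl rl]; case: (eqVneq y (inv_letter x)) => //= yx.
by rewrite yl rl !andbT; apply: contraNneq yx => -[->].
Qed.

Lemma free_reduced_pushes l u : free_reduced l -> free_reduced (pushes l u).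
Proof. by elim: u l => //= x u IH l rl; apply/IH/free_reduced_push. Qed.

(** The homomorphism to the free group on bool that psi induces; None stands for 1. *)
Definition free_image (u : word A) : word bool :=
  pmap (fun x => omap (fun y => (y, x.2)) (psi x.1)) u.

Hypothesis psi_relator : forall l, free_reduced l -> pushes l (free_image w) = l.

Lemma free_image_cat u v : free_image (u ++ v) = free_image u ++ free_image v.
Proof. exact: pmap_cat. Qed.

Lemma pushes_cat l u v : pushes l (u ++ v) = pushes (pushes l u) v.
Proof. exact: foldl_cat. Qed.

Lemma pushes_pres u v l : pres_eq w u v -> free_reduced l ->
  pushes l (free_image u) = pushes l (free_image v).
Proof.
move=> uv rl; elim: uv => {u v} // [v u u' _ -> _ //|u x v|u v].
  rewrite !free_image_cat !pushes_cat; congr pushes.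
  rewrite /free_image /=; case: (psi x.1) => //= y.
  by rewrite (@pushK _ (y, x.2)) // free_reduced_pushes.
by rewrite !free_image_cat !pushes_cat psi_relator // free_reduced_pushes.
Qed.

Lemma size_pushes l u : size (pushes l u) <= size l + size u.
Proof.
elim: u l => [|x u IH] l; first by rewrite addn0.
rewrite /= (leq_trans (IH _)) // addnS -addSn leq_add2r.
by case: l => //= y l; case: ifP => // _; rewrite ltnW.
Qed.

Notation a := (false, false).
Notation b := (true, false).
Notation a' := (false, true).
Notation b' := (true, true).

Hypothesis psi_prefix : forall p, p \in proper_prefixes w ->
  exists2 k, 0 < k <= 4 & forall l, free_reduced l ->
    pushes l (free_image p) = pushes l (take k [:: a; b; a'; b']).

Definition positives (l : word bool) := count (fun x => ~~ x.2) l.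

(** The induction hypothesis for a product l of k factors among a, ab, aba^-1 and
    [a,b].  A factor begins with a and can only cancel a final a^-1 of l, which is
    then preceded by b, so that nothing further cancels.  Only the factor a, after
    a final a^-1, adds no positive letter; the strict inequality in the first
    branch stores the reserve for it. *)
Definition grown (k : nat) (l : word bool) : bool :=
  match l with
  | a' :: b :: _ => k < (positives l).*2
  | a' :: _ => false
  | _ => k <= (positives l).*2
  end.

Lemma grown_step k m l : 0 < m <= 4 -> grown k l ->
  grown k.+1 (pushes l (take m [:: a; b; a'; b'])).
Proof.
case: m => [|[|[|[|[|]]]]] // _; case: l => [|[[] []] [|[[] []] l]] //=;
  rewrite /positives /=; lia.
Qed.

Lemma commutator_linear : linear_prefix_products w.
Proof.
exists 2 => ps u sub /eltP/pushes_pres E.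
have gr : grown (size ps) (pushes [::] (free_image (flatten ps))).
  elim/last_ind: ps sub {E} => [|ps p IH] sub //.
  have [|k k4 kE] := psi_prefix (p := p).
    by apply: sub; rewrite mem_rcons mem_head.
  rewrite flatten_rcons free_image_cat pushes_cat kE ?free_reduced_pushes // size_rcons.
  apply: grown_step => //; apply: IH => q qs.
  by apply: sub; rewrite mem_rcons inE qs orbT.
have : size ps <= (positives (pushes [::] (free_image (flatten ps)))).*2.
  by move: gr; case: (pushes _ _) => [|[[] []] [|[[] []] l]] //= /ltnW.
move/leq_trans; apply; rewrite E // mul2n leq_double.
rewrite (leq_trans (count_size _ _)) // (leq_trans (size_pushes _ _)) //=.
rewrite add0n /free_image size_pmap.
exact: leq_trans (count_size _ _) _.
Qed.

End FreeGroup.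

(** * The free quotient of an orientable surface group *)

Section HigherGenus.
Variable n : nat.

(** The free generators a and b are the booleans false and true. *)
Definition fold_generator (x : 'I_n.+2 + 'I_n.+2) : option bool :=
  match x with
  | inl i => if i == ord0 then Some false else if i == ord_max then Some true else None
  | inr i => if i == ord0 then Some true else if i == ord_max then Some false else None
  end.

Let w := orientable_relator n.+2.
Let first_comm : word ('I_n.+2 + 'I_n.+2)%type := commutator_word ord0.
Let last_comm : word ('I_n.+2 + 'I_n.+2)%type := commutator_word ord_max.
Let middle : word ('I_n.+2 + 'I_n.+2)%type :=
  flatten [seq commutator_word i |
    i <- map (lift ord0) (map (widen_ord (leqnSn n)) (enum 'I_n))].

Lemma orientable_split : w = first_comm ++ middle ++ last_comm.
Proof.
rewrite /w /orientable_relator enum_ordSl enum_ordSr /middle map_rcons.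
rewrite -cats1 /= map_cat flatten_cat /=.
by rewrite (_ : lift ord0 ord_max = ord_max) //; apply: val_inj.
Qed.

Lemma free_image_middle k : free_image fold_generator (take k middle) = [::].
Proof.
have : {subset take k middle <= middle} by move=> x; apply: mem_take.
elim: (take k middle) => //= x s IH sub.
rewrite /free_image /= -/(free_image _ _) IH; last first.
  by move=> y ys; apply: sub; rewrite inE ys orbT.
have /flattenP[_ /mapP[_ /mapP[_ /mapP[i _ ->] ->] ->]] := sub x (mem_head _ _).
have i1 : (lift ord0 (widen_ord (leqnSn n) i) == ord0) = false by [].
have i2 : (lift ord0 (widen_ord (leqnSn n) i) == ord_max) = false.
  by apply/negbTE; rewrite -val_eqE /= /bump /= add1n eqSS neq_ltn ltn_ord.
by rewrite !inE => /or4P[] /eqP-> /=; rewrite ?i1 ?i2.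
Qed.

Lemma higher_genus_linear : linear_prefix_products w.
Proof.
have mid : free_image fold_generator middle = [::].
  by have := free_image_middle (size middle); rewrite take_size.
have takeE k : free_image fold_generator (take k last_comm) =
    take k [:: (true, false); (false, false); (true, true); (false, true)].
  by case: k => [|[|[|[|[|k]]]]]; rewrite /free_image /= ?eqxx.
have lastE : free_image fold_generator last_comm = _ := takeE 4.
apply: (@commutator_linear _ _ fold_generator) => [l rl|p].
  rewrite orientable_split !free_image_cat mid lastE.
  rewrite /free_image /= /pushes /=.
  rewrite (@pushK _ (true, true)) ?free_reduced_push //.
  rewrite (@pushK _ (false, true)) ?free_reduced_push //.
  rewrite (@pushK _ (true, false)) ?free_reduced_push //.
  by rewrite (@pushK _ (false, false)).
move=> /mapP[i]; rewrite mem_iota orientable_split.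
have [i4 ibd ->|i4 ibd ->] := leqP i 4.
  rewrite take_cat; case: ltnP => [_|i4'].
    exists i; first lia.
    by move=> l _; case: i i4 {ibd} => [|[|[|[|[|]]]]] //=.
  have -> : i = 4 by apply/eqP; rewrite eqn_leq i4.
  by exists 4 => // l _; rewrite [X in _ ++ X]take0 cats0.
rewrite take_cat; case: ltnP => [|_]; first by rewrite ltnNge (ltnW i4).
rewrite take_cat.
case: ltnP => im.
  by exists 4 => // l _; rewrite free_image_cat free_image_middle.
rewrite !free_image_cat mid.
have [k kE k4] : exists2 k, k = i - 4 - size middle & k < 4.
  exists (i - 4 - size middle) => //.
  by move: ibd; rewrite !size_cat /=; lia.
(* The letters b, a, b^-1 of the last commutator undo b^-1, a^-1, b in turn. *)
rewrite -kE; case: k k4 {kE} => [|[|[|[|]]]] // _;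
  [exists 4|exists 3|exists 2|exists 1] => // l rl.
all: rewrite takeE /= /pushes /=.
- by rewrite (@pushK _ (true, true)) // !free_reduced_push.
- rewrite (@pushK _ (true, true)) ?free_reduced_push //.
  by rewrite (@pushK _ (false, true)) // !free_reduced_push.
- rewrite (@pushK _ (true, true)) ?free_reduced_push //.
  rewrite (@pushK _ (false, true)) ?free_reduced_push //.
  by rewrite (@pushK _ (true, false)) // free_reduced_push.
Qed.

End HigherGenus.

(** * Surface groups *)

Lemma nil_linear (A : finType) (w : word A) : w = [::] -> linear_prefix_products w.
Proof. by move=> ->; exists 0 => -[|p ps] u // /(_ p (mem_head _ _)). Qed.

Lemma solvable_decidable (A : finType) (w : word A) :
  coxeter_word_problem w -> linear_prefix_products w -> decidable_prefix_membership w.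
Proof.
by move=> [I [comm [phi wp]]] [c bound]; apply: decidable_prefixes wp _ bound.
Qed.

Lemma linear_distortion (A : finType) (w : word A) :
  linear_prefix_products w -> has_linear_upper_distortion (prefix_monoid w).
Proof. by move=> [c bound]; apply: prefix_monoid_linear_distortion bound. Qed.

Lemma orientable_linear g : linear_prefix_products (orientable_relator g).
Proof.
case: g => [|[|n]]; last exact: higher_genus_linear; last exact: torus_linear.
by apply: nil_linear; rewrite /orientable_relator enum_ord0.
Qed.

Lemma nonorientable_linear_neq1 g :
  g <> 1 -> linear_prefix_products (nonorientable_relator g).
Proof.
case: g => [|[|n]] // _; last exact: nonorientable_linear.
by apply: nil_linear; rewrite /nonorientable_relator enum_ord0.
Qed.

(** The group has two elements, both in the prefix monoid. *)
Lemma nonorientable1_decidable : decidable_prefix_membership (nonorientable_relator 1).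
Proof.
pose w := nonorientable_relator 1; rewrite -/w.
have wE : w = [:: (ord0, false); (ord0, false)].
  by rewrite /w /nonorientable_relator enum_ordSl enum_ord0.
have Pa : prefix_monoid w (elt w [:: (ord0, false)]).
  by apply/prefix_monoidP; exists [:: [:: (ord0, false)]]; rewrite // wE.
apply: decidable_all => -[a []]; rewrite (ord1 a) //.
suff -> : elt w [:: (ord0, true)] = elt w [:: (ord0, false)] by [].
rewrite -[[:: (ord0, true)]]/(inv_word [:: (ord0, false)]) elt_inv.
by apply: mulg1_eq; rewrite -elt_cat /= -wE elt_relator.
Qed.

Theorem theorem6p19 :
  (forall g : nat,
     decidable_prefix_membership (orientable_relator g) /\
     has_linear_upper_distortion (prefix_monoid (orientable_relator g))) /\
  (forall g : nat,
     decidable_prefix_membership (nonorientable_relator g) /\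
     (g <> 1%N ->
      has_linear_upper_distortion (prefix_monoid (nonorientable_relator g)))).
Proof.
split=> g; split.
- exact: solvable_decidable (orientable_coxeter g) (orientable_linear g).
- exact/linear_distortion/orientable_linear.
- have [->|/eqP g1] := eqVneq g 1; first exact: nonorientable1_decidable.
  exact: solvable_decidable (nonorientable_coxeter g) (nonorientable_linear_neq1 g1).
- by move=> g1; apply/linear_distortion/nonorientable_linear_neq1.
Qed.
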